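(* Assume [H1]. Then the value function $u$ satisfies $u(x,T)=g(x)$ for all $x\in\mathcal G$, and it is a viscosity solution of $$-\partial_t u+H_i(x,t,Du)=0 \ \text{ for } x\in J_i\setminus\{O\},\qquad -\partial_t u+H_O(t,Du)=0\ \text{ at } x=O,$$ in the following sense: for every $(x,t)\in\mathcal G\times(0,T)$ and every $\varphi\in C^1(\mathcal G\times[0,T])$ such that $u-\varphi$ has a local maximum (resp. local minimum) at $(x,t)$, one has $-\partial_t\varphi(x,t)+H_i(x,t,D\varphi(x,t))\le 0$ (resp. $\ge 0$) if $x\in J_i\setminus\{O\}$, and $-\partial_t\varphi(O,t)+H_O(t,D\varphi(O,t))\le 0$ (resp. $\ge0$) if $x=O$.
   Context: Let $N\ge 2$, $d\ge 1$, and let $e_1,\dots,e_N\in\mathbb R^d$ be pairwise distinct unit vectors. Let $J_i=\{s e_i: s\ge 0\}$, $\mathcal G=\bigcup_{i=1}^N J_i$ and $O=0$, with geodesic distance $d(x,y)=|x-y|$ if $x,y$ lie in a common $J_i$ and $d(x,y)=|x|+|y|$ otherwise. Fix $T>0$. For $i=0,\dots,N$ let $A_i=\{i\}\times\mathbb R$, $A=\bigcup_{i=0}^N A_i$ (disjoint union); for $a=(i,\bar a)$ write $|a|=|\bar a|$. Let $M=\{(x,a): x\in\mathcal G,\ a\in A_i \text{ if } x\in J_i\setminus\{O\},\ a\in A \text{ if } x=O\}$ and $f:M\to\mathbb R^d$, $f(x,(i,\bar a))=\bar a e_i$ for $i\ge1$, $f(O,(0,\bar a))=0$. For $0\le t<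 T$ and $x\in\mathcal G$, $\Gamma_t[x]$ is the set of pairs $(y,\alpha)$ with $y\in W^{1,2}([t,T];\mathcal G)$, $\alpha:[t,T]\to A$ measurable, $(y(s),\alpha(s))\in M$ a.e., $\int|\alpha|^2<\infty$, $y(s)=x+\int_t^s f(y(\tau),\alpha(\tau))d\tau$. [H1]: for $i=1,\dots,N$, $\ell_i:J_i\times[0,T]\to\mathbb R$ and $g_i:J_i\to\mathbb R$ continuous and bounded; $\ell_*:[0,T]\to\mathbb R$ continuous and bounded; $g_*\in\mathbb R$. $\ell_O(t)=\min\{\ell_*(t),\min_i\ell_i(O,t)\}$; $L(x,t)=\ell_i(x,t)$ for $x\in J_i\setminus\{O\}$, $L(O,t)=\ell_O(t)$; $g=g_i$ on $J_i\setminus\{O\}$, $g(O)=\min\{g_*,\min_i g_i(O)\}$. $J_t(x;(y,\alpha))=\int_t^T\big(L(y(\tau),\tau)+\tfrac12|\alpha(\tau)|^2\big)d\tau+g(y(T))$, $u(x,t)=\inf_{\Gamma_t[x]}J_t(x;\cdot)$ for $t<T$ and $u(x,T)=g(x)$. $C^1(\mathcal G\times[0,T])$ is the set of continuous $\varphi$ on $\mathcal G\times[0,T]$ whose restriction to each $J_i\times[0,T]$, viewed as a function of $(\bar x,t)\in\mathbb R^+\times[0,T]$ via $\bar x\mapsto\bar x e_i$, is $C^1$ (one-sided derivatives at the boundary). $D\varphi(x,t)=D\varphi_{|J_i}(x,t)\in\mathbb R$ (derivative in $\bar x$) if $x\in J_i\setminus\{O\}$, and $D\varphi(O,t)=(D\varphi_{|J_1}(O,t),\dots,D\varphi_{|J_N}(O,t))\in\mathbb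 R^N$. Hamiltonians: $H_i(x,t,p)=\sup_{a\in\mathbb R}\{-pa-a^2/2-\ell_i(x,t)\}=p^2/2-\ell_i(x,t)$ for $x\in J_i$, $p\in\mathbb R$; $H_i^{\downarrow}(O,t,p)=\sup_{a\ge 0}\{-pa-a^2/2-\ell_i(O,t)\}$ (which equals $p^2/2-\ell_i(O,t)$ if $p\le 0$ and $-\ell_i(O,t)$ if $p>0$); for $p=(p_1,\dots,p_N)\in\mathbb R^N$, $H_O(t,p)=\max\{-\ell_O(t),\max_{i=1,\dots,N}H_i^{\downarrow}(O,t,p_i)\}$. *)

(* Defs.v *)
From HB Require Import structures.
From mathcomp Require Import all_boot all_order all_algebra.
From mathcomp Require Import all_classical all_reals all_analysis.
Set Implicit Arguments. Unset Strict Implicit. Unset Printing Implicit Defensive.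
Import Order.TTheory GRing.Theory Num.Theory.
Import numFieldNormedType.Exports.
Local Open Scope classical_set_scope.
Local Open Scope ring_scope.

Section Junction.
Variables (R : realType) (N d : nat) (e : 'I_N -> 'rV[R]_d) (T : R).

Definition Icc (a b : R) : set R := [set` `[a, b]%R].

Definition enorm (v : 'rV[R]_d) : R := Num.sqrt (\sum_(k < d) (v ord0 k) ^+ 2).

Definition ray (i : 'I_N) (x : 'rV[R]_d) : Prop := exists s : R, 0 <= s /\ x = s *: e i.

Definition inG (x : 'rV[R]_d) : Prop := exists i, ray i x.

Definition gdist (x y : 'rV[R]_d) : R :=
  if `[< exists i, ray i x /\ ray i y >] then enorm (x - y) else enorm x + enorm y.

(* data: l i sbar t = l_i(sbar e_i, t), ls = l_*, gi i sbar = g_i(sbar e_i), gs = g_* *)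
Variables (l : 'I_N -> R -> R -> R) (ls : R -> R) (gi : 'I_N -> R -> R) (gs : R).

Definition lO (t : R) : R := \big[Num.min/ls t]_(i < N) l i 0 t.
Definition gO : R := \big[Num.min/gs]_(i < N) gi i 0.

Definition Lcost (x : 'rV[R]_d) (t : R) : R :=
  if x == 0 then lO t else
  match [pick i | `[< ray i x >] ] with Some i => l i (enorm x) t | None => 0 end.
Definition gcost (x : 'rV[R]_d) : R :=
  if x == 0 then gO else
  match [pick i | `[< ray i x >] ] with Some i => gi i (enorm x) | None => 0 end.

(* control set A = disjoint union of A_0 (None) and A_i (Some i), i = 1..N *)
Definition ctrl := (option 'I_N * R)%type.

Definition fdyn (a : ctrl) : 'rV[R]_d :=
  match a.1 with Some i => a.2 *: e i | None => 0 end.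

Definition inM (x : 'rV[R]_d) (a : ctrl) : Prop :=
  x = 0 \/ exists i, a.1 = Some i /\ ray i x.

(* measurability of alpha : [t,T] -> A for the disjoint-union sigma-algebra *)
Definition ctrl_measurable (t : R) (alpha : R -> ctrl) : Prop :=
  (forall o : option 'I_N, measurable ([set s | (alpha s).1 = o] `&` (Icc t T)))
  /\ measurable_fun (Icc t T) (fun s => (alpha s).2).

Definition admissible (t : R) (x : 'rV[R]_d) (y : R -> 'rV[R]_d) (alpha : R -> ctrl) : Prop :=
  [/\ forall s, t <= s <= T -> inG (y s),
      ctrl_measurable t alpha,
      {ae (@lebesgue_measure R), forall s, (Icc t T) s -> inM (y s) (alpha s)},
      (@lebesgue_measure R).-integrable (Icc t T) (fun s => (((alpha s).2) ^+ 2)%:E)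
    & forall s, t <= s <= T -> forall k : 'I_d,
        y s ord0 k = x ord0 k + Rintegral (@lebesgue_measure R) (Icc t s)
                                  (fun tau => fdyn (alpha tau) ord0 k)].

Definition Jcost (t : R) (y : R -> 'rV[R]_d) (alpha : R -> ctrl) : R :=
  Rintegral (@lebesgue_measure R) (Icc t T)
    (fun tau => Lcost (y tau) tau + ((alpha tau).2) ^+ 2 / 2) + gcost (y T).

Definition uval (x : 'rV[R]_d) (t : R) : R :=
  if t < T then
    inf [set Jcost t ya.1 ya.2 | ya in [set ya : (R -> 'rV[R]_d) * (R -> ctrl) |
                                        admissible t x ya.1 ya.2]]
  else gcost x.

Definition Hi (i : 'I_N) (sbar t p : R) : R := p ^+ 2 / 2 - l i sbar t.
Definition Hdown (i : 'I_N) (t p : R) : R :=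
  if p <= 0 then p ^+ 2 / 2 - l i 0 t else - l i 0 t.
Definition HO (t : R) (p : 'I_N -> R) : R :=
  \big[Num.max/ - lO t]_(i < N) Hdown i t (p i).

(* the quarter-strip [0,+oo) x [0,T] parametrizing J_i x [0,T] *)
Definition Qstrip : set (R * R) := [set q | 0 <= q.1 /\ 0 <= q.2 <= T].

Definition restr (phi : 'rV[R]_d -> R -> R) (i : 'I_N) (sbar t : R) : R := phi (sbar *: e i) t.

Definition has_dx (F : R -> R -> R) (s t p : R) : Prop :=
  (fun h => h^-1 * (F (s + h) t - F s t)) @ within (fun h => 0 <= s + h) (0^') --> p.
Definition has_dt_strip (F : R -> R -> R) (s t p : R) : Prop :=
  (fun h => h^-1 * (F s (t + h) - F s t)) @ within (fun h => 0 <= t + h <= T) (0^') --> p.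

Definition C1strip (F : R -> R -> R) : Prop :=
  exists px pt : R -> R -> R,
    [/\ forall s t, Qstrip (s, t) -> has_dx F s t (px s t),
        forall s t, Qstrip (s, t) -> has_dt_strip F s t (pt s t),
        {within Qstrip, continuous (fun q => px q.1 q.2)}
      & {within Qstrip, continuous (fun q => pt q.1 q.2)}].

Definition C1G (phi : 'rV[R]_d -> R -> R) : Prop :=
  (forall x t, inG x -> 0 <= t <= T -> forall eps : R, 0 < eps ->
     exists2 del : R, 0 < del & forall y s, inG y -> 0 <= s <= T ->
       gdist x y < del -> `|s - t| < del -> `|phi y s - phi x t| < eps)
  /\ forall i, C1strip (restr phi i).

(* time derivative of phi at (x,t) (t interior) *)
Definition has_dt (phi : 'rV[R]_d -> R -> R) (x : 'rV[R]_d) (t p : R) : Prop :=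
  (fun h => h^-1 * (phi x (t + h) - phi x t)) @ 0^' --> p.

Definition loc_max (w : 'rV[R]_d -> R -> R) (x : 'rV[R]_d) (t : R) : Prop :=
  exists2 r : R, 0 < r & forall y s, inG y -> 0 <= s <= T ->
    gdist x y < r -> `|s - t| < r -> w y s <= w x t.
Definition loc_min (w : 'rV[R]_d -> R -> R) (x : 'rV[R]_d) (t : R) : Prop :=
  exists2 r : R, 0 < r & forall y s, inG y -> 0 <= s <= T ->
    gdist x y < r -> `|s - t| < r -> w x t <= w y s.

Definition H1 : Prop :=
  [/\ forall i, {within Qstrip, continuous (fun q => l i q.1 q.2)}
             /\ exists M : R, forall s t, Qstrip (s, t) -> `|l i s t| <= M,
      forall i, {within [set s : R | 0 <= s], continuous (gi i)}
             /\ exists M : R, forall s, 0 <= s -> `|gi i s| <= M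
    & {within (Icc 0 T), continuous ls} /\ exists M : R, forall t, 0 <= t <= T -> `|ls t| <= M].

End Junction.

(* Main.v *)
Require Import Defs.
From HB Require Import structures.
From mathcomp Require Import all_boot all_order all_algebra.
From mathcomp Require Import all_classical all_reals all_analysis.
From mathcomp Require Import measurable_realfun lra ring.
Import Order.TTheory GRing.Theory Num.Theory.
Import numFieldNormedType.Exports.
Local Open Scope classical_set_scope.
Local Open Scope ring_scope.

(** Both viscosity inequalities are read off the dynamic programming principle, using the test
    function only at the two endpoints of a short piece of trajectory, so no chain rule along
    trajectories is needed. For the subsolution inequality one moves along a ray at constant
    speed (or rests at O). For the supersolution inequality one takes a trajectory that is
    optimal up to eta * h on [t, t + h]: Young's inequality
    lam * |y(b) - y(a)| <= int_a^b |alpha|^2 / 2 + lam^2 (b - a) / 2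
    both bounds the oscillation of y uniformly and absorbs the gradient term of the test
    function. At the junction the trajectory is cut at its last visit to O: before that time
    only L >= l_O is used, afterwards the trajectory stays on one ray J_j, and the two pieces
    are controlled by the entries -l_O and H_j^down of the maximum defining H_O. *)


(** The obstacle is in the supersolution inequality. A nearly optimal trajectory has merely bounded
    energy, so its displacement over a time h need not be O(h), and the remainder eta * |y(t + h) -
    x| of the expansion of the test function cannot be divided by h. Young's weight is therefore lam
    = |p| + eta instead of |p|: the energy pays for the gradient term and the remainder together, at
    the price (|p| + eta)^2 / 2, which tends to p^2 / 2 with eta. At the junction |p| is replaced by
    max(- p_j, 0), the rate at which the test function can decrease when leaving O along J_j; half
    its square minus l_j is exactly H_j^down. Division by h then leaves a weighted mean of two
    entries of H_O, the weights being the durations of the two pieces. Since near-optimality is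
    measured by eta * h, the step h has to be fixed before the trajectory; this is possible because
    the energy bound depends on the data alone. The test function is expanded on each ray
    separately, and the finiteness of N gives a common radius. *)

(** * Integrals on closed intervals: restriction, pasting, comparison *)

Section IntervalIntegral.
Local Set Implicit Arguments.
Local Unset Strict Implicit.
Variable R : realType.
Local Notation mu := (@lebesgue_measure R).
Local Notation ibl a b f := (mu.-integrable (Icc a b) (EFin \o f)).
Local Notation int a b f := (Rintegral mu (Icc a b) f).
Implicit Types (a b c k : R) (f g : R -> R).

Lemma IccP a b s : Icc a b s <-> a <= s <= b.
Proof. by rewrite /Icc /= in_itv /=. Qed.

Lemma measurable_Icc a b : @measurable _ (measurableTypeR R) (Icc a b).
Proof. exact: measurable_itv. Qed.

Lemma subset_Icc a b c k : a <= c -> k <= b -> Icc c k `<=` Icc a b.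
Proof. by move=> ac kb s /IccP/andP[cs sk]; apply/IccP; rewrite (le_trans ac)// (le_trans sk). Qed.

Lemma integrable_sub_Icc a b c k f : a <= c -> k <= b -> ibl a b f -> ibl c k f.
Proof.
by move=> ac kb; apply: integrableS; [exact: measurable_Icc..|exact: subset_Icc].
Qed.

Lemma measurable_Icc_glue a c b f : a <= c <= b ->
  measurable_fun (Icc a c) f -> measurable_fun (Icc c b) f -> measurable_fun (Icc a b) f.
Proof.
move=> /andP[ac cb] m1 m2.
have -> : Icc a b = Icc a c `|` Icc c b.
  apply/seteqP; split=> s.
    by move=> /IccP/andP[as_ sb]; case: (leP s c) => sc; [left|right]; apply/IccP; rewrite ?as_ ?sb ?(ltW sc).
  by case; apply: subset_Icc.
by apply/measurable_funU; [exact: measurable_Icc..|split].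
Qed.

(** A pasted control switches by the test [s <= c], so on the second closed piece it agrees with the
    second control only off the left endpoint. This lemma and the next ones discard that single
    point. *)
Lemma measurable_Icc_left a b f g : (forall s, a < s <= b -> f s = g s) ->
  measurable_fun (Icc a b) g -> measurable_fun (Icc a b) f.
Proof.
move=> fg mg; case: (leP a b) => ab; last first.
  rewrite (_ : Icc a b = set0); first exact: measurable_fun_set0.
  by apply/seteqP; split=> s // /IccP/andP[as_ sb]; move: (le_trans as_ sb); rewrite leNgt ab.
have -> : Icc a b = [set a] `|` [set` `]a, b]%R].
  apply/seteqP; split=> s /=.
    move=> /IccP/andP[]; rewrite le_eqVlt in_itv /= => /predU1P[->|as_ sb]; first by left.
    by right; rewrite as_.
  by case=> [->|]; [apply/IccP; rewrite lexx|rewrite in_itv /= => /andP[/ltW as_ sb]; apply/IccP; rewrite as_].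
apply/measurable_funU => //; split; first exact: measurable_fun_set1.
apply: (@eq_measurable_fun _ _ _ _ _ g).
  by move=> s; rewrite inE /= in_itv /= => /fg.
apply: measurable_funS mg; first exact: measurable_Icc.
by move=> s /=; rewrite in_itv /= => /andP[/ltW as_ sb]; apply/IccP; rewrite as_.
Qed.

Lemma ae_eq_Icc_left a b f g : (forall s, a < s <= b -> f s = g s) ->
  ae_eq mu (Icc a b) (EFin \o f) (EFin \o g).
Proof.
move=> fg; exists [set a]; split; [exact: measurable_set1|exact: lebesgue_measure_set1|].
move=> s /= /not_implyP[/IccP/andP[as_ sb] nfg]; apply/eqP; apply/negPn/negP => sa.
by apply: nfg; rewrite fg// sb lt_neqAle as_ eq_sym sa.
Qed.

Lemma eq_int_Icc_left a b f g : (forall s, a < s <= b -> f s = g s) ->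
  ibl a b g -> int a b f = int a b g.
Proof.
move=> fg /measurable_int mg; congr fine.
have mg' : measurable_fun (Icc a b) g by exact/measurable_EFinP.
have mf : measurable_fun (Icc a b) f by apply: measurable_Icc_left mg'.
apply: ae_eq_integral; [exact: measurable_Icc|exact/measurable_EFinP|exact/measurable_EFinP|].
exact: ae_eq_Icc_left.
Qed.

Lemma integrable_Icc_left a b f g : (forall s, a < s <= b -> f s = g s) ->
  ibl a b g -> ibl a b f.
Proof.
move=> fg /integrableP[mg fin].
have mg' : measurable_fun (Icc a b) g by exact/measurable_EFinP.
have mf : measurable_fun (Icc a b) f by apply: measurable_Icc_left mg'.
apply/integrableP; split; first exact/measurable_EFinP.
rewrite (_ : integral _ _ _ = (\int[mu]_(x in Icc a b) `|(EFin \o g) x|)%E) //.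
apply: ae_eq_integral; [exact: measurable_Icc| | |].
- by apply: measurableT_comp => //; exact/measurable_EFinP.
- by apply: measurableT_comp => //; exact/measurable_EFinP.
- apply: filterS (@ae_eq_Icc_left a b f g fg) => s H Ds; congr abse; exact: H.
Qed.

Lemma int_Icc_chasles a c b f : a <= c <= b -> ibl a b f ->
  int a b f = int a c f + int c b f.
Proof.
move=> /andP[ac cb] fi.
have /eqP := @Rintegral_itvB R f (BLeft a) (BRight b) c fi ac cb.
rewrite subr_eq => /eqP H.
rewrite /Icc H addrC; congr +%R; apply: Rintegral_itv_obnd_cbnd.
apply: integrableS fi; [exact: measurable_itv..|].
by move=> s /=; rewrite in_itv /= => /andP[/ltW cs sb]; apply/IccP; rewrite sb (le_trans ac).
Qed.

Lemma integrable_Icc_glue a c b f : a <= c <= b -> ibl a c f -> ibl c b f -> ibl a b f.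
Proof.
move=> /andP[ac cb] /integrableP[m1 f1] /integrableP[m2 f2].
have mf : measurable_fun (Icc a b) f.
  by apply: (@measurable_Icc_glue a c); [rewrite ac|exact/measurable_EFinP..].
apply/integrableP; split; first exact/measurable_EFinP.
(* The second piece is half-open so that the union is disjoint. *)
have E : Icc a b = Icc a c `|` [set` `]c, b]%R].
  apply/seteqP; split=> s.
    by move=> /IccP/andP[as_ sb]; case: (leP s c) => sc; [left; apply/IccP|right; rewrite /= in_itv /=]; rewrite ?as_ ?sb ?sc.
  case; first exact: subset_Icc.
  by rewrite /= in_itv /= => /andP[cs sb]; apply/IccP; rewrite sb (le_trans ac) ?ltW.
rewrite E ge0_integral_setU//; [|exact: measurable_Icc| |].
- apply: lte_add_pinfty => //.
  apply: le_lt_trans f2; apply: ge0_subset_integral => //; [exact: measurable_Icc| |].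
    by apply: measurableT_comp => //; exact: m2.
  by move=> s /=; rewrite in_itv /= => /andP[cs sb]; apply/IccP; rewrite sb ltW.
- rewrite -E; apply: measurableT_comp => //; exact/measurable_EFinP.
- rewrite disj_set2E; apply/eqP/seteqP; split=> s // -[/IccP/andP[_ sc]].
  by rewrite /= in_itv /= => /andP[]; rewrite ltNge sc.
Qed.

Lemma lebesgue_Icc a b : a <= b -> mu (Icc a b) = (b - a)%:E.
Proof.
rewrite le_eqVlt /Icc lebesgue_measure_itv /= lte_fin => /predU1P[->|->].
  by rewrite ltxx subrr.
by rewrite EFinB.
Qed.

Lemma int_Icc_cst a b k : a <= b -> int a b (fun=> k) = k * (b - a).
Proof.
move=> ab; rewrite Rintegral_cst; last exact: measurable_Icc.
exact: (congr1 (fun z => k * fine z) (lebesgue_Icc ab)).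
Qed.

Lemma integrable_Icc_bounded a b k f : measurable_fun (Icc a b) f ->
  (forall s, a <= s <= b -> `|f s| <= k) -> ibl a b f.
Proof.
move=> mf fk; apply: measurable_bounded_integrable => //; first exact: measurable_Icc.
- case: (leP a b) => [ab|ba].
    exact: (eq_ind_r (fun z => (z < +oo)%E) (ltry _) (lebesgue_Icc ab)).
  by rewrite /Icc set_itv_ge ?measure0// bnd_simp -ltNge.
- by exists k; split; [exact: num_real|]=> M kM s /= /IccP/fk H; rewrite (le_trans H)// ltW.
Qed.

Lemma integrable_Icc_cst a b k : ibl a b (fun=> k).
Proof. by apply: (@integrable_Icc_bounded _ _ `|k|) => //; exact: measurable_cst. Qed.

Lemma int_Icc_le a b f g : ibl a b f -> ibl a b g ->
  (forall s, a <= s <= b -> f s <= g s) -> int a b f <= int a b g.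
Proof.
by move=> fi gi fg; apply: le_Rintegral; [exact: measurable_Icc|exact: fi|exact: gi|move=> s /IccP/fg].
Qed.

Lemma int_Icc_point a f : int a a f = 0.
Proof. by rewrite /Icc set_itv1 Rintegral_set1. Qed.

Lemma integrable_IccZl a b k f : ibl a b f -> ibl a b (fun s => k * f s).
Proof.
move=> fi. have H := integrableZl (measurable_Icc a b) k fi.
apply: eq_integrable H; first exact: measurable_Icc.
by move=> s _ /=; rewrite EFinM.
Qed.

Lemma integrable_IccD a b f g : ibl a b f -> ibl a b g -> ibl a b (fun s => f s + g s).
Proof.
move=> fi gi; apply: eq_integrable (integrableD (measurable_Icc a b) fi gi); first exact: measurable_Icc.
by move=> s _ /=; rewrite EFinD.
Qed.

Lemma le_integrable_Icc a b f g : measurable_fun (Icc a b) f ->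
  (forall s, a <= s <= b -> `|f s| <= g s) -> ibl a b g -> ibl a b f.
Proof.
move=> mf fg gi; apply: (le_integrable (measurable_Icc a b) _ _ gi).
  exact/measurable_EFinP.
by move=> s /IccP/fg H; rewrite /= lee_fin (le_trans H)// ler_norm.
Qed.

Lemma int_IccZl a b k f : ibl a b f -> int a b (fun s => k * f s) = k * int a b f.
Proof. by move=> fi; apply: RintegralZl => //; exact: measurable_Icc. Qed.

Lemma int_IccD a b f g : ibl a b f -> ibl a b g ->
  int a b (fun s => f s + g s) = int a b f + int a b g.
Proof. by move=> fi gi; apply: RintegralD => //; exact: measurable_Icc. Qed.

End IntervalIntegral.


(** * First-order expansion of C^1 functions on a strip *)

Section FirstOrder.
Local Set Implicit Arguments.
Local Unset Strict Implicit.
Variable R : realType.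
Implicit Types (f : R -> R) (F : R -> R -> R).

Lemma continuous_within_epsP (A : set R) f :
  {within A, continuous f} <-> forall x, A x -> forall eps, 0 < eps ->
     exists2 del : R, 0 < del & forall y, A y -> `|y - x| < del -> `|f y - f x| < eps.
Proof.
split=> [/subspace_continuousP H x Ax eps eps0|H].
  have /cvgrPdist_lt /(_ eps eps0) := H x Ax.
  rewrite near_withinE => /nbhs_ballP[del del0 Hd]; exists del => // y Ay yx.
  by rewrite distrC; apply: Hd => //=; rewrite /ball /= distrC.
apply/subspace_continuousP => x Ax; apply/cvgrPdist_lt => eps eps0.
have [del del0 Hd] := H x Ax eps eps0.
rewrite near_withinE; apply/nbhs_ballP; exists del => //= y.
by rewrite /ball /= distrC => yx Ay; rewrite distrC; exact: Hd.
Qed.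

Lemma continuous_strip_eps (T : R) F :
  {within Qstrip T, continuous (fun q => F q.1 q.2)} ->
  forall s t, 0 <= s -> 0 <= t <= T -> forall eps, 0 < eps ->
    exists2 del : R, 0 < del & forall s' t', 0 <= s' -> 0 <= t' <= T ->
      `|s' - s| < del -> `|t' - t| < del -> `|F s' t' - F s t| < eps.
Proof.
move=> /subspace_continuousP H s t s0 tT eps eps0.
have /cvgrPdist_lt /(_ eps eps0) := H (s, t) (conj s0 tT).
rewrite near_withinE => /nbhs_ballP[del del0 Hd]; exists del => // s' t' s'0 t'T ss tt.
rewrite distrC; apply: (Hd (s', t')) => //=.
by rewrite /ball /= /prod_ball /= /ball /= !(distrC _ s') !(distrC _ t').
Qed.

Lemma cvg_within_dnbhs0 (A : set R) f (p : R) :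
  f @ within A 0^' --> p <-> forall eps, 0 < eps ->
    exists2 del : R, 0 < del & forall h, h != 0 -> `|h| < del -> A h -> `|f h - p| < eps.
Proof.
split=> [/cvgrPdist_lt H eps eps0|H].
  have := H eps eps0; rewrite near_withinE => /nbhs_ballP[del del0 Hd].
  exists del => // h h0 hd Ah; rewrite distrC; apply: Hd => //=.
  by rewrite /ball /= sub0r normrN.
apply/cvgrPdist_lt => eps eps0; have [del del0 Hd] := H eps eps0.
rewrite near_withinE; apply/nbhs_ballP; exists del => //= h.
by rewrite /ball /= sub0r normrN => hd h0 Ah; rewrite distrC; exact: Hd.
Qed.

Lemma diff_quotient_bound (x h p eps : R) : h != 0 -> `|h^-1 * x - p| < eps ->
  `|x - h * p| <= eps * `|h|.
Proof.
move=> h0 H; have -> : x - h * p = (h^-1 * x - p) * h by rewrite mulrBl mulrAC mulVf// mul1r mulrC.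
by rewrite normrM ler_wpM2r// ltW.
Qed.

Lemma has_dx_eps F s t p : 0 <= s -> has_dx F s t p -> forall eps, 0 < eps ->
  exists2 del : R, 0 < del & forall s', 0 <= s' -> `|s' - s| < del ->
    `|F s' t - F s t - (s' - s) * p| <= eps * `|s' - s|.
Proof.
move=> s0 /cvg_within_dnbhs0 H eps eps0; have [del del0 Hd] := H eps eps0.
exists del => // s' s'0 ss.
have [->|ne] := eqVneq s' s; first by rewrite !subrr mul0r subr0 normr0 mulr0.
apply: diff_quotient_bound; first by rewrite subr_eq0.
by have := Hd (s' - s); rewrite subr_eq0 (addrC s) subrK; exact.
Qed.

(** At a common small step h > 0, two distinct values would give h * |p - q| <= h * |p - q| / 2.
    Uniqueness identifies a derivative given by hypothesis with the continuous [px] of [C1strip]. *)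
Lemma has_dx_unique F s t p q : 0 <= s -> has_dx F s t p -> has_dx F s t q -> p = q.
Proof.
move=> s0 Hp Hq; apply/eqP/negPn/negP => pq.
have e0 : 0 < `|p - q| / 4 by rewrite divr_gt0// normr_gt0 subr_eq0.
have [d1 d10 H1] := has_dx_eps s0 Hp e0.
have [d2 d20 H2] := has_dx_eps s0 Hq e0.
pose h := Order.min d1 d2 / 2.
have h0 : 0 < h by rewrite divr_gt0// lt_min d10.
have hm : h < Order.min d1 d2 by rewrite /h gtr_pMr ?invf_lt1 ?ltr1n// lt_min d10.
move: hm; rewrite lt_min => /andP[hd1 hd2].
have E : s + h - s = h by rewrite addrC addKr.
have sh : 0 <= s + h by rewrite addr_ge0// ltW.
have := H1 _ sh; have := H2 _ sh; rewrite E gtr0_norm// => /(_ hd2) A /(_ hd1) B.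
have := ler_normB (F (s+h) t - F s t - h * q) (F (s+h) t - F s t - h * p).
rewrite (_ : _ - _ = h * (p - q)); last by ring.
rewrite normrM gtr0_norm// => C.
have npq : 0 < `|p - q| by rewrite normr_gt0 subr_eq0.
nra.
Qed.

Lemma has_dx_is_derive F s t p : 0 < s -> has_dx F s t p -> is_derive s 1 (F ^~ t) p.
Proof.
move=> s0 H.
have C : (fun h : R => h^-1 *: (F (h *: 1 + s) t - F s t)) @ 0^' --> p.
  apply/cvgrPdist_lt => eps eps0.
  have /cvg_within_dnbhs0 /(_ eps eps0) [del del0 Hd] := H.
  apply/nbhs_ballP; exists (Order.min del s) => /=; first by rewrite lt_min del0.
  move=> h; rewrite /ball /= sub0r normrN lt_min => /andP[hd hs] h0.
  rewrite distrC /GRing.scale /= mulr1 (addrC h); apply: Hd => //.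
  by move: hs; rewrite ltr_norml => /andP[] ? _; lra.
apply: DeriveDef; first by apply/cvg_ex; exists p.
exact: cvg_lim C.
Qed.

(** The mean value theorem asks for a derivative inside ]a, b[, where s > 0 and the one-sided
    quotient is two-sided; at the endpoints, 0 included, [has_dx] supplies continuity. *)
Lemma has_dx_MVT F (px : R -> R) t a b : 0 <= a -> a <= b ->
  (forall s, 0 <= s -> has_dx F s t (px s)) ->
  exists2 c, a <= c <= b & F b t - F a t = px c * (b - a).
Proof.
move=> a0 ab H.
suff cF : {within `[a, b], continuous (F ^~ t)}.
  have dF x : x \in `]a, b[%R -> is_derive x 1 (F ^~ t) (px x).
    move=> /itvP xab; apply: has_dx_is_derive; first by rewrite (le_lt_trans a0)// xab.
    by apply: H; rewrite (le_trans a0)// xab.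
  have [c /itvP cab E] := MVT_segment ab dF cF.
  by exists c => //; rewrite !cab.
apply/continuous_within_epsP => x /= /itvP xab eps eps0.
  have x0 : 0 <= x by rewrite (le_trans a0)// xab.
  have [d d0 Hd] := has_dx_eps x0 (H x x0) ltr01.
  have P0 : 0 < `|px x| + 1 by rewrite ltr_wpDl.
  (* Near x the increment is at most (|px x| + 1) * |y - x|. *)
  exists (Order.min d (eps / (`|px x| + 1))); first by rewrite lt_min d0 divr_gt0.
  move=> y /itvP yab; rewrite lt_min ltr_pdivlMr// => /andP[yd ye].
  have := Hd y; rewrite (le_trans a0) ?yab// => /(_ isT yd); rewrite mul1r => B.
  apply: le_lt_trans ye.
  rewrite mulrDr mulr1 -normrM -[X in `|X|](subrK ((y - x) * px x)).
  by rewrite (le_trans (ler_normD _ _))// addrC lerD2l.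
Qed.

(** The increment is split at (s, t'). The time part is differentiability in t at the fixed abscissa
    s; the space part, at time t', is the mean value theorem, and joint continuity of [px] brings
    its slope back to p. *)
Lemma first_order_strip (T : R) F s t dt p : C1strip T F -> 0 <= s -> 0 < t < T ->
  (fun h => h^-1 * (F s (t + h) - F s t)) @ 0^' --> dt ->
  has_dx F s t p -> forall eta, 0 < eta ->
  exists2 del : R, 0 < del & forall s' t', 0 <= s' -> 0 <= t' <= T ->
    `|s' - s| < del -> `|t' - t| < del ->
    `|F s' t' - F s t - (t' - t) * dt - (s' - s) * p| <= eta * (`|t' - t| + `|s' - s|).
Proof.
move=> [px [pt [Hx _ cx _]]] s0 /andP[t0 tT] Ht Hp eta eta0.
have tT' : 0 <= t <= T by rewrite !ltW.
have Qst : Qstrip T (s, t) by split; rewrite /= ?tT'.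
have Ep : p = px s t by exact: (has_dx_unique s0 Hp (Hx _ _ Qst)).
have [d1 d10 H1] := continuous_strip_eps cx s0 tT' eta0.
move/cvgrPdist_lt : Ht => /(_ eta eta0) /nbhs_ballP[d2 /= d20 H2].
exists (Order.min d1 d2); first by rewrite lt_min d10 d20.
move=> s' t' s'0 t'T; rewrite !lt_min => /andP[ss _] /andP[tt1 tt2].
have A : `|F s t' - F s t - (t' - t) * dt| <= eta * `|t' - t|.
  have [->|ne] := eqVneq t' t; first by rewrite !subrr mul0r subr0 normr0 mulr0.
  apply: diff_quotient_bound; first by rewrite subr_eq0.
  rewrite distrC; have := H2 (t' - t); rewrite (addrC t) subrK; apply; last by rewrite subr_eq0.
  by rewrite /ball /= sub0r normrN.
have B : `|F s' t' - F s t' - (s' - s) * p| <= eta * `|s' - s|.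
  have Hx' : forall r, 0 <= r -> has_dx F r t' (px r t') by move=> r r0; apply: Hx; split.
  have [c cs E] : exists2 c, 0 <= c /\ `|c - s| <= `|s' - s| & F s' t' - F s t' = px c t' * (s' - s).
    case: (leP s s') => ss'.
      have [c /andP[c1 c2] E] := has_dx_MVT s0 ss' Hx'.
      exists c => //; split; first exact: le_trans c1.
      by rewrite !ger0_norm ?subr_ge0// lerD2r.
    have [c /andP[c1 c2] E] := has_dx_MVT s'0 (ltW ss') Hx'.
    exists c; last by rewrite -opprB E -mulrN opprB.
    split; first exact: le_trans c1.
    by rewrite !ler0_norm ?subr_le0// ?(ltW ss')// lerN2 lerD2r.
  rewrite E mulrC -mulrBr normrM mulrC ler_wpM2r// Ep.
  by case: cs => c0 cs; apply/ltW/H1 => //; exact: le_lt_trans cs ss.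
rewrite (_ : _ - _ - _ = (F s t' - F s t - (t' - t) * dt) + (F s' t' - F s t' - (s' - s) * p)); last by ring.
by rewrite (le_trans (ler_normD _ _))// mulrDr lerD.
Qed.

End FirstOrder.


(** * Finite minima: common radii and continuity *)

Section FiniteMinima.
Local Set Implicit Arguments.
Local Unset Strict Implicit.
Variables (R : realType) (n : nat).

(** For bounds that must hold on all rays at once, and for the angular gap between one ray and the
    others. *)
Lemma finite_uniform_radius (P : 'I_n -> R -> Prop) :
  (forall i d d', 0 < d' -> d' <= d -> P i d -> P i d') ->
  (forall i, exists2 d : R, 0 < d & P i d) ->
  exists2 d : R, 0 < d & forall i, P i d.
Proof.
move=> mono H; have /choice[f fP] : forall i, exists d : R, 0 < d /\ P i d.
  by move=> i; have [d d0 Pd] := H i; exists d.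
(* The seed 1 keeps the minimum positive when n = 0. *)
have m0 : 0 < \big[Order.min/1]_(i < n) f i.
  by apply: lt_bigmin => // i _; case: (fP i).
exists (\big[Order.min/1]_(i < n) f i) => // i.
by apply: mono m0 _ (fP i).2; exact: bigmin_le.
Qed.

(** Minima are 1-Lipschitz for the sup distance; by symmetry the one-sided bound [W] is enough. *)
Lemma bigmin_close (a a' : R) (f g : 'I_n -> R) eps :
  `|a' - a| < eps -> (forall i, `|g i - f i| < eps) ->
  `|\big[Order.min/a']_(i < n) g i - \big[Order.min/a]_(i < n) f i| < eps.
Proof.
move=> aa fg.
suff W (b b' : R) (u v : 'I_n -> R) : `|b' - b| < eps -> (forall i, `|v i - u i| < eps) ->
    \big[Order.min/b]_(i < n) u i - eps < \big[Order.min/b']_(i < n) v i.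
  have := W _ _ _ _ aa fg.
  have gf i : `|f i - g i| < eps by rewrite distrC.
  rewrite distrC in aa; have := W _ _ _ _ aa gf.
  by rewrite ltr_norml => A B; apply/andP; split; lra.
move=> bb uv; apply: lt_bigmin.
  have : \big[Order.min/b]_(i < n) u i <= b by exact: bigmin_le_id.
  by move: bb; rewrite ltr_norml => /andP[] ? ? ?; lra.
move=> i _; have : \big[Order.min/b]_(i < n) u i <= u i by exact: bigmin_le.
by move: (uv i); rewrite ltr_norml => /andP[] ? ? ?; lra.
Qed.

End FiniteMinima.

(** * Last zero of a continuous function *)

Section LastZero.
Local Set Implicit Arguments.
Local Unset Strict Implicit.
Variable R : realType.

(** The point c is the supremum of the points where psi <= 0. Applied to a psi that vanishes on the
    network exactly at O, it is the last visit to O. *)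
Lemma last_zero (psi : R -> R) (a b : R) : a <= b ->
  {within (Icc a b), continuous psi} -> psi a = 0 -> 0 < psi b ->
  exists2 c, a <= c < b & psi c = 0 /\ forall x, c < x <= b -> 0 < psi x.
Proof.
move=> ab /continuous_within_epsP cpsi pa pb.
pose S := [set x | a <= x <= b /\ psi x <= 0].
have Sa : S a by split; rewrite ?lexx ?pa.
have ubS : ubound S b by move=> x [/andP[]].
have hS : has_sup S by split; [exists a|exists b].
pose c := sup S.
have ac : a <= c by apply: ub_le_sup => //; case: hS.
have cb : c <= b by apply: ge_sup => //; exists a.
have cI : Icc a b c by apply/IccP; rewrite ac.
have after x : c < x <= b -> 0 < psi x.
  move=> /andP[cx xb]; rewrite ltNge; apply/negP => px.
  have : S x by split => //; rewrite xb (le_trans ac)// ltW.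
  by move/(ub_le_sup (ex_intro _ b ubS)); rewrite leNgt cx.
have pc : psi c <= 0.
  rewrite leNgt; apply/negP => pc.
  have [d d0 Hd] := cpsi c cI _ pc.
  have [x Sx cx] := sup_adherent d0 hS.
  have xc : x <= c by apply: ub_le_sup Sx; exists b.
  have xI : Icc a b x by apply/IccP; case: Sx.
  have := Hd x xI; rewrite ler0_norm ?subr_le0// => /(_ _)-/(_ ltac:(rewrite /c; lra)).
  by case: Sx => _; rewrite ltr_norml => ? /andP[]; lra.
have cb' : c < b.
  by rewrite lt_neqAle cb andbT; apply/eqP => E; move: pc; rewrite E leNgt pb.
(* If psi c < 0, continuity keeps psi negative slightly to the right of c, against [after]; the cap
   by b keeps the test point in the interval. *)
exists c; rewrite ?ac//; split => //; apply/eqP; rewrite eq_le pc leNgt; apply/negP => pc0.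
have e0 : 0 < - psi c by rewrite oppr_gt0.
have [d d0 Hd] := cpsi c cI _ e0.
pose x := Order.min (c + d / 2) b.
have cx : c < x by rewrite lt_min cb' andbT ltrDl divr_gt0.
have xb : x <= b by rewrite ge_min lexx orbT.
have xd : x <= c + d / 2 by rewrite ge_min lexx.
have xI : Icc a b x by apply/IccP; rewrite xb (le_trans ac)// ltW.
have := after x; rewrite cx xb => /(_ isT) px.
have := Hd x xI; rewrite gtr0_norm ?subr_gt0// => /(_ ltac:(lra)).
by rewrite ltr_norml => /andP[]; lra.
Qed.

End LastZero.


(** * Geometry of the rays *)

Section Junction.
Local Set Implicit Arguments.
Local Unset Strict Implicit.
Variables (R : realType) (N d : nat) (e : 'I_N -> 'rV[R]_d).
Hypothesis e_unit : forall i, enorm (e i) = 1.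
Hypothesis e_inj : injective e.

Definition dot (v w : 'rV[R]_d) : R := \sum_(k < d) v ord0 k * w ord0 k.

Lemma dotC v w : dot v w = dot w v.
Proof. by apply: eq_bigr => k _; rewrite mulrC. Qed.

Lemma dotZl (a : R) v w : dot (a *: v) w = a * dot v w.
Proof. by rewrite /dot mulr_sumr; apply: eq_bigr => k _; rewrite mxE mulrA. Qed.

Lemma dotZr (a : R) v w : dot w (a *: v) = a * dot w v.
Proof. by rewrite dotC dotZl dotC. Qed.

Lemma dotBl u v w : dot (u - v) w = dot u w - dot v w.
Proof. by rewrite /dot -sumrB; apply: eq_bigr => k _; rewrite !mxE mulrBl. Qed.

Lemma dotBr u v w : dot w (u - v) = dot w u - dot w v.
Proof. by rewrite dotC dotBl !(dotC w). Qed.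

Lemma dot0l w : dot 0 w = 0.
Proof. by rewrite /dot big1// => k _; rewrite mxE mul0r. Qed.

Lemma dotvv v : dot v v = \sum_(k < d) (v ord0 k) ^+ 2.
Proof. by apply: eq_bigr => k _; rewrite expr2. Qed.

Lemma dotvv_ge0 v : 0 <= dot v v.
Proof. by rewrite dotvv sumr_ge0// => k _; rewrite sqr_ge0. Qed.

Lemma enormE v : enorm v = Num.sqrt (dot v v).
Proof. by rewrite /enorm dotvv. Qed.

Lemma dotvv_eq0 v : dot v v = 0 -> v = 0.
Proof.
rewrite dotvv => /eqP; rewrite psumr_eq0 => [/allP H|k _]; last exact: sqr_ge0.
apply/rowP => k; rewrite mxE; apply/eqP.
by have := H k (mem_index_enum _); rewrite sqrf_eq0.
Qed.

Lemma dot_ee i : dot (e i) (e i) = 1.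
Proof.
have := e_unit i; rewrite enormE => H.
by rewrite -(sqr_sqrtr (dotvv_ge0 (e i))) H expr1n.
Qed.

Lemma dot_ee_le1 i j : dot (e i) (e j) <= 1.
Proof.
have := dotvv_ge0 (e i - e j); rewrite dotBl !dotBr !dot_ee (dotC (e j)); lra.
Qed.

Lemma dot_ee_geN1 i j : -1 <= dot (e i) (e j).
Proof.
have := dotvv_ge0 (e i - (-1) *: e j).
by rewrite dotBl !dotBr !dotZr !dotZl !dot_ee (dotC (e j)); lra.
Qed.

Lemma dot_ee_norm i j : `|dot (e i) (e j)| <= 1.
Proof. by rewrite ler_norml dot_ee_le1 dot_ee_geN1. Qed.

Lemma dot_ee_lt1 i j : i != j -> dot (e i) (e j) < 1.
Proof.
move=> ij; rewrite lt_neqAle dot_ee_le1 andbT; apply/eqP => E.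
have /dotvv_eq0/eqP : dot (e i - e j) (e i - e j) = 0.
  by rewrite dotBl !dotBr !dot_ee (dotC (e j)) E subrr.
by rewrite subr_eq0 => /eqP/e_inj/eqP; rewrite (negbTE ij).
Qed.

Lemma coord_ee_norm i k : `|e i ord0 k| <= 1.
Proof.
rewrite -(ler_pXn2r (n := 2))// ?nnegrE// expr1n -normrX ger0_norm ?sqr_ge0//.
rewrite -(dot_ee i) dotvv (bigD1 k)//= lerDl sumr_ge0// => l _; exact: sqr_ge0.
Qed.

Lemma enormZe (s : R) i : enorm (s *: e i) = `|s|.
Proof.
by rewrite enormE dotZl dotZr dot_ee mulr1 -expr2 sqrtr_sqr.
Qed.

Lemma rayZ_eq0 (s : R) i : (s *: e i == 0) = (s == 0).
Proof.
apply/eqP/eqP => [E|->]; last exact: scale0r.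
by apply/eqP; rewrite -normr_eq0 -(enormZe s i) E enormE dot0l sqrtr0.
Qed.

Lemma ray_inj (s s' : R) i j : 0 < s -> 0 <= s' -> s *: e i = s' *: e j -> i = j /\ s = s'.
Proof.
move=> s0 s'0 E; have : enorm (s *: e i) = enorm (s' *: e j) by rewrite E.
rewrite !enormZe gtr0_norm// ger0_norm// => ss'; split => //; apply: e_inj.
have s1 : s != 0 by rewrite gt_eqF.
by move: E; rewrite -ss' => /(scalerI s1).
Qed.

Lemma pick_ray (s : R) i : 0 < s -> [pick j | `[< ray e j (s *: e i) >]] = Some i.
Proof.
move=> s0; case: pickP => [j /asboolP[s' [s'0 E]]|/(_ i)].
  by have [-> _] := ray_inj s0 s'0 E.
by move=> /negP[]; apply/asboolP; exists s; rewrite ltW.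
Qed.

Lemma ray0 i : ray e i 0.
Proof. by exists 0; rewrite scale0r. Qed.

Lemma rayZ (s : R) i : 0 <= s -> ray e i (s *: e i).
Proof. by exists s. Qed.

Lemma inG_ray (s : R) i : 0 <= s -> inG e (s *: e i).
Proof. by exists i; exact: rayZ. Qed.

Lemma gdist_ray (s s' : R) i : 0 <= s -> 0 <= s' ->
  gdist e (s *: e i) (s' *: e i) = `|s' - s|.
Proof.
move=> s0 s'0; rewrite /gdist ifT; first by rewrite -scalerBl enormZe distrC.
by apply/asboolP; exists i; split; exact: rayZ.
Qed.

(** Closeness is expressed by projections on the directions because these are what Young's
    inequality controls. If y = r e_j with j different from i and x = dot (e j) (e i) > 0, the
    projections on e_i and e_j give s * (1 - x) <= eps, against the angular gap 1 - x >= c. *)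
Lemma near_ray i (s del : R) : 0 < s -> 0 < del ->
  exists2 eps : R, 0 < eps & forall y, inG e y ->
    (forall k, `|dot (y - s *: e i) (e k)| <= eps) ->
    exists2 s', 0 < s' & y = s' *: e i /\ `|s' - s| < del.
Proof.
move=> s0 del0.
have [c c0 Hc] : exists2 c : R, 0 < c & forall k, k != i -> dot (e k) (e i) <= 1 - c.
  apply: (@finite_uniform_radius R N (fun k c => k != i -> dot (e k) (e i) <= 1 - c)).
    by move=> k x x' _ xx' H /H; lra.
  move=> k; have [->|ki] := eqVneq k i; first by exists 1.
  exists (1 - dot (e k) (e i)); first by rewrite subr_gt0 dot_ee_lt1.
  by move=> _; lra.
(* The bound s / 2 keeps r > 0 and excludes rays at a nonpositive cosine, s * c / 2 excludes the
   other rays, and del / 2 makes the final inequality strict. *)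
pose eps := Order.min (Order.min (s / 2) (s * c / 2)) (del / 2).
have eps0 : 0 < eps by rewrite !lt_min !divr_gt0// mulr_gt0.
have [e1 e2 e3] : [/\ eps <= s / 2, eps <= s * c / 2 & eps <= del / 2].
  by rewrite /eps; split; rewrite !ge_min lexx ?orbT.
exists eps => // y [j [r [r0 ->]]] H.
have := H i; rewrite dotBl !dotZl dot_ee mulr1 ler_norml => /andP[A1 A2].
have [ji|ji] := eqVneq j i.
  subst j; rewrite dot_ee in A1 A2.
  exists r; first lra.
  by split => //; rewrite ltr_norml; apply/andP; split; lra.
have := H j; rewrite dotBl !dotZl dot_ee mulr1 dotC ler_norml => /andP[B1 B2].
exfalso; have := Hc j ji; set x := dot (e j) (e i) in A1 A2 B1 B2 *.
move=> xc; have [x0|x0] := leP x 0; first by nra.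
nra.
Qed.

Lemma radial_le y (eps : R) : inG e y -> (forall k, `|dot y (e k)| <= eps) ->
  exists i r, [/\ 0 <= r, r <= eps & y = r *: e i].
Proof.
move=> [i [r [r0 ->]]] H; exists i, r; split => //.
by have := H i; rewrite dotZl dot_ee mulr1 ger0_norm.
Qed.

Lemma continuous_coord_dot (A : set R) (y : R -> 'rV[R]_d) w :
  (forall k, {within A, continuous (fun s => y s ord0 k)}) ->
  {within A, continuous (fun s => dot (y s) w)}.
Proof.
move=> cy; apply/subspace_continuousP => x Ax.
rewrite /dot; apply: cvg_big => [|k _]; first exact: add_continuous.
by apply: cvgMr_tmp; have /subspace_continuousP/(_ x Ax) := cy k.
Qed.

Lemma continuous_coord_enorm (A : set R) (y : R -> 'rV[R]_d) :
  (forall k, {within A, continuous (fun s => y s ord0 k)}) ->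
  {within A, continuous (fun s => enorm (y s))}.
Proof.
move=> cy; apply/subspace_continuousP => x Ax.
apply: (continuous_cvg (h := @Num.sqrt R) _ (@sqrt_continuous R _)).
apply: cvg_big => [|k _]; first exact: add_continuous.
under eq_fun do rewrite expr2.
by rewrite expr2; apply: cvgM; have /subspace_continuousP/(_ x Ax) := cy k.
Qed.

(** A continuous path changes ray only through O. The scalar function psi makes this accessible to
    [last_zero]. *)
Lemma ray_last_exit j (y : R -> 'rV[R]_d) (a b r : R) : a <= b ->
  (forall k, {within (Icc a b), continuous (fun s => y s ord0 k)}) ->
  (forall s, a <= s <= b -> inG e (y s)) ->
  y a = 0 -> 0 < r -> y b = r *: e j ->
  exists2 c, a <= c < b & y c = 0 /\
    forall s, c < s <= b -> exists2 s', 0 < s' & y s = s' *: e j.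
Proof.
move=> ab cy Gy ya r0 yb.
(* The slope 1 - k0 / 2 used in psi lies strictly between 1 - k0, which bounds the cosines of the
   other rays with e_j, and 1, the value for e_j itself. *)
have [k0 /andP[k00 k01] Hk] : exists2 k0 : R, 0 < k0 <= 1 &
    forall k, k != j -> dot (e k) (e j) <= 1 - k0.
  have [c c0 Hc] : exists2 c : R, 0 < c & forall k, k != j -> dot (e k) (e j) <= 1 - c.
    apply: (@finite_uniform_radius R N (fun k c => k != j -> dot (e k) (e j) <= 1 - c)).
      by move=> k x x' _ xx' H /H; lra.
    move=> k; have [->|ki] := eqVneq k j; first by exists 1.
    exists (1 - dot (e k) (e j)); first by rewrite subr_gt0 dot_ee_lt1.
    by move=> _; lra.
  exists (Order.min c 1); first by rewrite lt_min c0 ltr01 ge_min lexx orbT.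
  move=> k /Hc; have : Order.min c 1 <= c by rewrite ge_min lexx.
  lra.
(* On the network psi is positive on J_j minus O, negative on the other rays minus O, and 0 at O. *)
pose psi s := dot (y s) (e j) - (1 - k0 / 2) * enorm (y s).
have psiE (k : 'I_N) (s s' : R) : 0 <= s' -> y s = s' *: e k ->
    psi s = s' * (dot (e k) (e j) - (1 - k0 / 2)).
  by move=> s'0 E; rewrite /psi E dotZl enormZe ger0_norm//; ring.
have cpsi : {within (Icc a b), continuous psi}.
  apply/subspace_continuousP => x Ax; apply: cvgB.
    by have /subspace_continuousP/(_ x Ax) := continuous_coord_dot (w := e j) cy.
  by apply: cvgMl_tmp; have /subspace_continuousP/(_ x Ax) := continuous_coord_enorm cy.
have pa : psi a = 0 by rewrite /psi ya dot0l enormE dot0l sqrtr0 mulr0 subrr.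
have pb : 0 < psi b by rewrite (psiE j b r (ltW r0) yb) dot_ee mulr_gt0//; lra.
have [c cab [pc Hc]] := last_zero ab cpsi pa pb.
have /andP[ac cb] := cab.
exists c => //; split.
  have [|k [s' [s'0 E]]] := Gy c; first by rewrite ac ltW.
  move: pc; rewrite (psiE k _ s' s'0 E) => /eqP; rewrite mulf_eq0 => /orP[/eqP s'z|/eqP H].
    by rewrite E s'z scale0r.
  exfalso; have [kj|kj] := eqVneq k j; first by move: H; rewrite kj dot_ee; lra.
  by have := Hk k kj; lra.
move=> s /andP[cs sb].
have [|k [s' [s'0 E]]] := Gy s; first by rewrite sb (le_trans ac)// ltW.
have := Hc s; rewrite cs sb (psiE k _ s' s'0 E) => /(_ isT) H.
have s'p : 0 < s'.
  by rewrite lt_neqAle s'0 andbT; apply/eqP => Z; move: H; rewrite -Z mul0r ltxx.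
have [kj|kj] := eqVneq k j; first by exists s'; rewrite -?kj.
by move: H; rewrite pmulr_rgt0//; have := Hk k kj; lra.
Qed.

End Junction.


(** * Admissible trajectories: Young's inequality and equicontinuity *)

Section Trajectories.
Local Set Implicit Arguments.
Local Unset Strict Implicit.
Variables (R : realType) (N d : nat) (e : 'I_N -> 'rV[R]_d) (T : R).
Local Notation mu := (@lebesgue_measure R).
Local Notation ibl a b f := (mu.-integrable (Icc a b) (EFin \o f)).
Local Notation int a b f := (Rintegral mu (Icc a b) f).
Hypothesis e_unit : forall i, enorm (e i) = 1.
Hypothesis e_inj : injective e.

(** Carries the coordinatewise equation of [admissible] over to projections on a vector. *)
Lemma int_Icc_lincomb (I : Type) (r : seq I) a b (c : I -> R) (f : I -> R -> R) :
  (forall k, ibl a b (f k)) ->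
  ibl a b (fun s => \sum_(k <- r) c k * f k s) /\
  int a b (fun s => \sum_(k <- r) c k * f k s) = \sum_(k <- r) c k * int a b (f k).
Proof.
move=> fi; elim: r => [|k r [IH1 IH2]].
  under eq_fun do rewrite big_nil; rewrite big_nil; split.
    exact: integrable_Icc_cst.
  by rewrite Rintegral_cst ?mul0r//; exact: measurable_Icc.
have E : (fun s => \sum_(j <- k :: r) c j * f j s) =
    (fun s => c k * f k s + \sum_(j <- r) c j * f j s).
  by apply/funext => s; rewrite big_cons.
have ck : ibl a b (fun s => c k * f k s) by exact: integrable_IccZl.
rewrite E big_cons; split.
  exact: integrable_IccD.
by rewrite int_IccD// IH2 int_IccZl.
Qed.

Lemma dot_fdyn_le (a : ctrl R N) v : (forall i, `|dot (e i) v| <= 1) ->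
  `|dot (fdyn e a) v| <= `|a.2|.
Proof.
move=> Hv; rewrite /fdyn; case: a => [[i|] a] /=; last by rewrite dot0l normr0.
by rewrite dotZl normrM ler_piMr.
Qed.

(** As a finite sum over labels, the velocity becomes a family of conditionals on the level sets
    that [ctrl_measurable] makes measurable. *)
Lemma measurable_dot_fdyn t (alpha : R -> ctrl R N) v : ctrl_measurable T t alpha ->
  measurable_fun (Icc t T) (fun s => dot (fdyn e (alpha s)) v).
Proof.
move=> [m1 m2].
have -> : (fun s => dot (fdyn e (alpha s)) v) = (fun s => \sum_(i < N)
   (if (alpha s).1 == Some i then (alpha s).2 * dot (e i) v else 0)).
  apply/funext => s; rewrite /fdyn; case: (alpha s) => [[i|] a] /=.
    rewrite (bigD1 i)//= eqxx big1 ?addr0 ?dotZl// => k ki.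
    by rewrite ifN//; apply: contra ki => /eqP[->].
  by rewrite dot0l big1.
apply: measurable_sum => i; apply: measurable_fun_if; first exact: measurable_Icc.
- apply: (measurable_fun_bool true).
  rewrite (_ : _ `&` _ = [set s | (alpha s).1 = Some i] `&` Icc t T); first exact: m1.
  by apply/seteqP; split=> s [] /= A B; split => //; apply/eqP.
- apply: measurable_funM => //; apply: measurable_funS m2; first exact: measurable_Icc.
  exact: subIsetl.
- exact: measurable_cst.
Qed.

(** Turns the Young inequalities for all lam into a modulus of continuity: del depends on C0 and eps
    alone, hence serves every trajectory of energy at most C0. *)
Lemma young_small (C0 eps : R) : 0 <= C0 -> 0 < eps -> exists2 del : R, 0 < del &
  forall X E h, E <= C0 -> h < del -> (forall lam, 0 <= lam -> lam * X <= E + lam ^+ 2 * h / 2) ->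
    X < eps.
Proof.
move=> C00 eps0; pose lam := 2 * (C0 + 1) / eps.
(* This lam gives lam * eps = 2 * (C0 + 1), while h < eps / lam keeps the right-hand side below C0 +
   (C0 + 1). *)
have lam0 : 0 < lam by rewrite divr_gt0// mulr_gt0// ltr_wpDl.
exists (eps / lam) => [|X E h EC hd H]; first exact: divr_gt0.
have := H lam (ltW lam0); rewrite ltr_pdivlMr// mulrC in hd.
have le : lam * eps = 2 * (C0 + 1) by rewrite /lam mulfVK// gt_eqF.
move=> A; rewrite -(ltr_pM2l lam0) le.
have : lam ^+ 2 * h <= lam * eps by rewrite expr2 -mulrA ler_pM2l// ltW.
by rewrite le; lra.
Qed.

Section OneTrajectory.
Variables (t : R) (x : 'rV[R]_d) (y : R -> 'rV[R]_d) (alpha : R -> ctrl R N).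
Hypothesis adm : admissible e T t x y alpha.

Lemma adm_inG s : t <= s <= T -> inG e (y s).
Proof. by case: adm => H _ _ _ _; exact: H. Qed.

Lemma adm_integrable_sqr a b : t <= a -> b <= T -> ibl a b (fun s => ((alpha s).2) ^+ 2).
Proof. by case: adm => _ _ _ H _ ta bT; apply: integrable_sub_Icc ta bT H. Qed.

Lemma adm_integrable_energy a b : t <= a -> b <= T -> ibl a b (fun s => ((alpha s).2) ^+ 2 / 2).
Proof.
move=> ta bT; rewrite (_ : (fun s : R => _ / _) = (fun s : R => 2^-1 * (alpha s).2 ^+ 2)); last by apply/funext => s; rewrite mulrC.
by apply: integrable_IccZl; exact: adm_integrable_sqr.
Qed.

(** The velocity is dominated through |a| <= a^2 / 2 + 1 / 2. *)
Lemma adm_integrable_dot a b v : t <= a -> b <= T -> (forall i, `|dot (e i) v| <= 1) ->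
  ibl a b (fun s => dot (fdyn e (alpha s)) v).
Proof.
move=> ta bT Hv; apply: (integrable_sub_Icc ta bT).
have [_ mal _ _ _] := adm.
apply: (@le_integrable_Icc _ _ _ _ (fun s => ((alpha s).2) ^+ 2 / 2 + 1 / 2)).
- exact: measurable_dot_fdyn.
- move=> s _; rewrite (le_trans (dot_fdyn_le (alpha s) Hv))//.
  by have := sqr_ge0 (`|(alpha s).2| - 1); rewrite -(real_normK (num_real (alpha s).2)); nra.
- by apply: integrable_IccD; [exact: adm_integrable_energy|exact: integrable_Icc_cst].
Qed.

Lemma dot_delta (w : 'rV[R]_d) (k : 'I_d) : dot w (delta_mx 0 k) = w ord0 k.
Proof.
rewrite /dot (bigD1 k)//= mxE !eqxx mulr1 big1 ?addr0// => j jk.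
by rewrite mxE (negbTE jk) andbF mulr0.
Qed.

Lemma adm_integrable_coord a b k : t <= a -> b <= T ->
  ibl a b (fun s => fdyn e (alpha s) ord0 k).
Proof.
move=> ta bT.
have Hv i : `|dot (e i) (delta_mx 0 k)| <= 1 by rewrite dot_delta; exact: coord_ee_norm.
have := adm_integrable_dot ta bT Hv.
by rewrite (_ : (fun s => dot _ _) = (fun s => fdyn e (alpha s) ord0 k))//; apply/funext => s; rewrite dot_delta.
Qed.

Lemma adm_coord a b k : t <= a -> a <= b -> b <= T ->
  y b ord0 k = y a ord0 k + int a b (fun s => fdyn e (alpha s) ord0 k).
Proof.
move=> ta ab bT; case: adm => _ _ _ _ H.
rewrite H ?bT ?(le_trans ta)// [y a _ _]H ?ta ?(le_trans ab)// -addrA; congr (_ + _).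
by apply: int_Icc_chasles; rewrite ?ta//; exact: adm_integrable_coord.
Qed.

Lemma adm_dot a b v : t <= a -> a <= b -> b <= T ->
  dot (y b - y a) v = int a b (fun s => dot (fdyn e (alpha s)) v).
Proof.
move=> ta ab bT.
have [_] := @int_Icc_lincomb _ (index_enum 'I_d) a b (fun k => v ord0 k)
   (fun k s => fdyn e (alpha s) ord0 k) (fun k => adm_integrable_coord k ta bT).
rewrite (_ : (fun s => \sum_(k < d) _) = (fun s => dot (fdyn e (alpha s)) v)); last first.
  by apply/funext => s; rewrite dotC.
move=> ->; rewrite /dot; apply: eq_bigr => k _.
by rewrite !mxE (adm_coord k ta ab bT) mulrC addrAC subrr add0r.
Qed.

(** The pointwise inequality lam * |a| <= a^2 / 2 + lam^2 / 2, integrated. The normalisation of v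
    covers both the directions e_k and the coordinate vectors. *)
Lemma adm_young a b v lam : t <= a -> a <= b -> b <= T -> 0 <= lam ->
  (forall i, `|dot (e i) v| <= 1) ->
  lam * `|dot (y b - y a) v| <= int a b (fun s => ((alpha s).2) ^+ 2 / 2) + lam ^+ 2 * (b - a) / 2.
Proof.
move=> ta ab bT lam0 Hv; rewrite (adm_dot v ta ab bT).
have iE := adm_integrable_energy ta bT.
have ic := integrable_Icc_cst a b (lam ^+ 2 / 2).
have ig := adm_integrable_dot ta bT Hv.
have -> : int a b (fun s => ((alpha s).2) ^+ 2 / 2) + lam ^+ 2 * (b - a) / 2 =
    int a b (fun s => ((alpha s).2) ^+ 2 / 2 + lam ^+ 2 / 2).
  by rewrite int_IccD// int_Icc_cst//; congr (_ + _); ring.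
have iS : ibl a b (fun s => ((alpha s).2) ^+ 2 / 2 + lam ^+ 2 / 2).
  exact: integrable_IccD.
(* Allowing both signs of c yields the absolute value of the integral. *)
suff H c : `|c| = lam -> c * int a b (fun s => dot (fdyn e (alpha s)) v) <=
    int a b (fun s => ((alpha s).2) ^+ 2 / 2 + lam ^+ 2 / 2).
  have [Z|/ltW Z] := leP 0 (int a b (fun s => dot (fdyn e (alpha s)) v)).
    by rewrite ger0_norm//; apply: H; rewrite ger0_norm.
  by rewrite ler0_norm// mulrN -mulNr; apply: H; rewrite normrN ger0_norm.
move=> clam; rewrite -int_IccZl//; apply: int_Icc_le => //; first exact: integrable_IccZl.
move=> s _; have B := dot_fdyn_le (alpha s) Hv.
apply: (le_trans (ler_norm _)); rewrite normrM clam.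
apply: (le_trans (ler_wpM2l lam0 B)).
by have := sqr_ge0 (`|(alpha s).2| - lam); rewrite -(real_normK (num_real (alpha s).2)); nra.
Qed.

Lemma adm_energy_ge0 a b : 0 <= int a b (fun s => ((alpha s).2) ^+ 2 / 2).
Proof. by apply: Rintegral_ge0 => s _; rewrite divr_ge0// sqr_ge0. Qed.

Lemma adm_energy_sub a b : t <= a -> a <= b -> b <= T ->
  int a b (fun s => ((alpha s).2) ^+ 2 / 2) <= int t T (fun s => ((alpha s).2) ^+ 2 / 2).
Proof.
move=> ta ab bT; have tb := le_trans ta ab.
rewrite (@int_Icc_chasles _ t b T) ?tb//; last exact: adm_integrable_energy.
rewrite (@int_Icc_chasles _ t a b) ?ta//; last exact: adm_integrable_energy.
have := adm_energy_ge0 t a; have := adm_energy_ge0 b T; lra.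
Qed.

(** Continuity comes from the energy: Young's bound with v a coordinate vector, fed into
    [young_small]. *)
Lemma adm_continuous k : {within (Icc t T), continuous (fun s => y s ord0 k)}.
Proof.
apply/continuous_within_epsP.
have W (eps : R) : 0 < eps -> exists2 del : R, 0 < del & forall a b, t <= a -> a <= b -> b <= T ->
    b - a < del -> `|y b ord0 k - y a ord0 k| < eps.
  move=> eps0; have [del del0 H] := young_small (adm_energy_ge0 t T) eps0.
  exists del => // a b ta ab bT bd; apply: (H _ _ _ (adm_energy_sub ta ab bT) bd) => lam lam0.
  have Hv i : `|dot (e i) (delta_mx 0 k)| <= 1 by rewrite dot_delta; exact: coord_ee_norm.
  by have := adm_young ta ab bT lam0 Hv; rewrite dot_delta !mxE.
move=> a /IccP/andP[ta aT] eps /W[del del0 H]; exists del => // b /IccP/andP[tb bT].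
have [ab|/ltW ba] := leP a b; first by rewrite ger0_norm ?subr_ge0//; exact: H.
by rewrite ler0_norm ?subr_le0// opprB distrC; exact: H.
Qed.

End OneTrajectory.

End Trajectories.


(** * The costs: bounds, continuity, measurability along a path *)

Section Cost.
Local Set Implicit Arguments.
Local Unset Strict Implicit.
Variables (R : realType) (N d : nat) (e : 'I_N -> 'rV[R]_d) (T : R).
Variables (l : 'I_N -> R -> R -> R) (ls : R -> R) (gi : 'I_N -> R -> R) (gs : R).
Local Notation mu := (@lebesgue_measure R).
Local Notation ibl a b f := (mu.-integrable (Icc a b) (EFin \o f)).
Local Notation int a b f := (Rintegral mu (Icc a b) f).
Local Notation L := (Lcost e l ls).
Local Notation g := (gcost e gi gs).
Local Notation J := (Jcost e T l ls gi gs).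
Local Notation u := (uval e T l ls gi gs).
Local Notation adm := (admissible e T).
Hypothesis e_unit : forall i, enorm (e i) = 1.
Hypothesis e_inj : injective e.
Hypothesis HH : H1 T l ls gi.

Lemma Lcost0 t : L 0 t = lO l ls t.
Proof. by rewrite /Lcost eqxx. Qed.

Lemma Lcost_ray i (s t : R) : 0 < s -> L (s *: e i) t = l i s t.
Proof.
move=> s0; rewrite /Lcost rayZ_eq0// gt_eqF// pick_ray// enormZe// gtr0_norm//.
Qed.

Lemma gcost_ray i (s : R) : 0 < s -> g (s *: e i) = gi i s.
Proof.
move=> s0; rewrite /gcost rayZ_eq0// gt_eqF// pick_ray// enormZe// gtr0_norm//.
Qed.

Lemma lO_le i t : lO l ls t <= l i 0 t.
Proof. exact: bigmin_le. Qed.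

Lemma l_eps i (s t : R) : 0 <= s -> 0 <= t <= T -> forall eps, 0 < eps ->
  exists2 del : R, 0 < del & forall s' t', 0 <= s' -> 0 <= t' <= T ->
      `|s' - s| < del -> `|t' - t| < del -> `|l i s' t' - l i s t| < eps.
Proof. by case: HH => Hl _ _; case: (Hl i) => cl _; exact: continuous_strip_eps cl s t. Qed.

Lemma lO_eps (t : R) : 0 <= t <= T -> forall eps, 0 < eps ->
  exists2 del : R, 0 < del & forall t', 0 <= t' <= T -> `|t' - t| < del ->
    `|lO l ls t' - lO l ls t| < eps.
Proof.
move=> tT eps eps0.
have [_ _ [/continuous_within_epsP cls _]] := HH.
have tI : Icc 0 T t by exact/IccP.
have [d1 d10 H1] := cls t tI eps eps0.
have [d2 d20 H2] : exists2 d2 : R, 0 < d2 & forall i t', 0 <= t' <= T -> `|t' - t| < d2 ->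
    `|l i 0 t' - l i 0 t| < eps.
  apply: (@finite_uniform_radius R N (fun i d2 => forall t', 0 <= t' <= T -> `|t' - t| < d2 ->
    `|l i 0 t' - l i 0 t| < eps)).
    by move=> i r r' _ rr' H t' t'T tt; apply: H => //; exact: lt_le_trans rr'.
  move=> i; have [r r0 H] := l_eps i (lexx 0) tT eps0; exists r => // t' t'T tt.
  by apply: H; rewrite ?subrr ?normr0.
exists (Order.min d1 d2); first by rewrite lt_min d10.
move=> t' t'T; rewrite lt_min => /andP[t1 t2].
by apply: bigmin_close => [|i]; [apply: H1 => //; exact/IccP|exact: H2].
Qed.

Lemma cost_bounded : exists2 K : R, 0 <= K &
  (forall x t, inG e x -> 0 <= t <= T -> `|L x t| <= K) /\ (forall x, inG e x -> `|g x| <= K).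
Proof.
have [Hl Hg [_ [Ms Hs]]] := HH.
have /choice[M1 HM1] : forall i, exists M : R, forall s t, Qstrip T (s, t) -> `|l i s t| <= M.
  by move=> i; case: (Hl i).
have /choice[M2 HM2] : forall i, exists M : R, forall s, 0 <= s -> `|gi i s| <= M.
  by move=> i; case: (Hg i).
pose K := `|Ms| + `|gs| + \sum_i `|M1 i| + \sum_i `|M2 i|.
have S1 i : `|M1 i| <= \sum_i `|M1 i| by rewrite (bigD1 i)//= lerDl sumr_ge0.
have S2 i : `|M2 i| <= \sum_i `|M2 i| by rewrite (bigD1 i)//= lerDl sumr_ge0.
have P1 : 0 <= \sum_i `|M1 i| by rewrite sumr_ge0.
have P2 : 0 <= \sum_i `|M2 i| by rewrite sumr_ge0.
have Ks : `|Ms| <= K by rewrite /K; have := normr_ge0 gs; lra.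
have Kg : `|gs| <= K by rewrite /K; have := normr_ge0 Ms; lra.
have K1 i : `|M1 i| <= K by rewrite /K; have := S1 i; have := normr_ge0 gs; have := normr_ge0 Ms; lra.
have K2 i : `|M2 i| <= K by rewrite /K; have := S2 i; have := normr_ge0 gs; have := normr_ge0 Ms; lra.
have B1 i s t : 0 <= s -> 0 <= t <= T -> `|l i s t| <= K.
  by move=> s0 tT; rewrite (le_trans (HM1 i s t _))// (le_trans (ler_norm _)).
have B2 i s : 0 <= s -> `|gi i s| <= K.
  by move=> s0; rewrite (le_trans (HM2 i s _))// (le_trans (ler_norm _)).
exists K; first by rewrite (le_trans _ Ks).
split=> [x t [i [s [s0 ->]]] tT|x [i [s [s0 ->]]]].
  have [->|sn] := eqVneq s 0; last by rewrite Lcost_ray ?B1// lt_neqAle eq_sym sn.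
  have Bs : `|ls t| <= K by rewrite (le_trans (Hs t tT))// (le_trans (ler_norm _)).
  rewrite scale0r Lcost0 ler_norml; apply/andP; split.
    apply: le_bigmin => [|k _]; first by move: Bs; rewrite ler_norml => /andP[].
    by have := B1 k 0 t (lexx _) tT; rewrite ler_norml => /andP[].
  by rewrite (le_trans (bigmin_le_id _ _ _ _))// (le_trans (ler_norm _)).
have [->|sn] := eqVneq s 0; last by rewrite gcost_ray ?B2// lt_neqAle eq_sym sn.
rewrite scale0r /gcost eqxx ler_norml; apply/andP; split.
  apply: le_bigmin => [|k _]; first by move: Kg; rewrite ler_norml => /andP[].
  by have := B2 k 0 (lexx _); rewrite ler_norml => /andP[].
by rewrite (le_trans (bigmin_le_id _ _ _ _))// (le_trans (ler_norm _)).
Qed.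

(** The equality case of Cauchy-Schwarz; it converts membership in a ray into an equation between
    continuous functions of y. *)
Lemma ray_dot_enorm y i : inG e y -> `[< ray e i y >] = (dot y (e i) == enorm y).
Proof.
move=> [k [s [s0 ->]]]; rewrite dotZl enormZe// ger0_norm//.
have [->|sn] := eqVneq s 0.
  by rewrite mul0r eqxx; apply/asboolP; rewrite scale0r; exact: ray0.
have sp : 0 < s by rewrite lt_neqAle eq_sym sn.
rewrite -[X in _ == X]mulr1 (inj_eq (mulfI sn)).
have [->|ki] := eqVneq k i.
  by rewrite dot_ee// eqxx; apply/asboolP; exact: rayZ.
rewrite lt_eqF ?dot_ee_lt1//; apply/asboolP => -[s' [s'0 E]].
by have [ki' _] := ray_inj e_unit e_inj sp s'0 E; rewrite ki' eqxx in ki.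
Qed.

(** The [pick] of [Lcost] is traded for conditionals on such equations, from which measurability
    along a path can be read off. Away from O exactly one condition holds. *)
Lemma Lcost_sum y t : inG e y -> L y t = if enorm y == 0 then lO l ls t else
  \sum_(i < N) (if dot y (e i) == enorm y then l i (enorm y) t else 0).
Proof.
move=> Gy; have [k [s [s0 E]]] := Gy.
have ns : enorm y = s by rewrite E enormZe// ger0_norm.
rewrite ns; have [z|sn] := eqVneq s 0; first by rewrite E z scale0r Lcost0.
have sp : 0 < s by rewrite lt_neqAle eq_sym sn.
rewrite {1}E Lcost_ray// (bigD1 k)//= big1.
  by rewrite addr0 -ns -(ray_dot_enorm k Gy) ifT//; apply/asboolP; rewrite E; exact: rayZ.
move=> i ik; rewrite -ns -(ray_dot_enorm i Gy) ifF//; apply/asboolP => -[s' [s'0 E']].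
by have [ki _] := ray_inj e_unit e_inj sp s'0 (etrans (esym E) E'); rewrite ki eqxx in ik.
Qed.

Lemma measurable_Lcost (t b : R) (y : R -> 'rV[R]_d) : 0 <= t -> b <= T ->
  (forall s, t <= s <= b -> inG e (y s)) ->
  (forall k, {within (Icc t b), continuous (fun s => y s ord0 k)}) ->
  measurable_fun (Icc t b) (fun s => L (y s) s).
Proof.
move=> t0 bT Gy cy.
have mcont (f : R -> R) : {within (Icc t b), continuous f} -> measurable_fun (Icc t b) f.
  by move=> cf; apply: subspace_continuous_measurable_fun => //; exact: measurable_Icc.
have sT s : t <= s <= b -> 0 <= s <= T.
  by move=> /andP[ts sb]; rewrite (le_trans t0)// (le_trans sb).
have cn := continuous_coord_enorm cy.
have mn := mcont _ cn.
apply: (@eq_measurable_fun _ _ _ _ _ (fun s => if enorm (y s) == 0 then lO l ls s else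
  \sum_(i < N) (if dot (y s) (e i) == enorm (y s) then l i (enorm (y s)) s else 0))).
  by move=> s /set_mem/IccP sI; rewrite Lcost_sum//; exact: Gy.
have mz : measurable_fun (Icc t b) (fun s => enorm (y s) == 0).
  by apply: measurable_fun_eqr => //; exact: measurable_cst.
apply: measurable_fun_if => //; first exact: measurable_Icc.
  apply: measurable_funS (measurable_Icc t b) (@subIsetl _ _ _) _.
  apply: mcont; apply/continuous_within_epsP => s /IccP sI eps eps0.
  have [del del0 H] := lO_eps (sT s sI) eps0; exists del => // s' /IccP s'I; exact: H (sT _ s'I).
apply: measurable_funS (measurable_Icc t b) (@subIsetl _ _ _) _.
apply: measurable_sum => i; apply: measurable_fun_if; first exact: measurable_Icc.
- by apply: measurable_fun_eqr => //; apply: mcont; exact: continuous_coord_dot.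
- apply: measurable_funS (measurable_Icc t b) (@subIsetl _ _ _) _.
  apply: mcont; apply/continuous_within_epsP => s sI eps eps0.
  have [del del0 H] := l_eps i (sqrtr_ge0 _ : 0 <= enorm (y s)) (sT s ((IccP _ _ _).1 sI)) eps0.
  move/continuous_within_epsP : cn => /(_ s sI del del0)[del' del'0 H'].
  exists (Order.min del del'); first by rewrite lt_min del0.
  move=> s' s'I; rewrite lt_min => /andP[s1 s2].
  by apply: H => //; [exact: sqrtr_ge0|exact/sT/IccP|exact: H'].
- exact: measurable_cst.
Qed.

End Cost.


(** * Pasting of trajectories and the dynamic programming principle *)

Section DynamicProgramming.
Local Set Implicit Arguments.
Local Unset Strict Implicit.
Variables (R : realType) (N d : nat) (e : 'I_N -> 'rV[R]_d) (T : R).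
Variables (l : 'I_N -> R -> R -> R) (ls : R -> R) (gi : 'I_N -> R -> R) (gs : R).
Local Notation mu := (@lebesgue_measure R).
Local Notation ibl a b f := (mu.-integrable (Icc a b) (EFin \o f)).
Local Notation int a b f := (Rintegral mu (Icc a b) f).
Local Notation L := (Lcost e l ls).
Local Notation g := (gcost e gi gs).
Local Notation J := (Jcost e T l ls gi gs).
Local Notation u := (uval e T l ls gi gs).
Local Notation adm := (admissible e T).
Hypothesis e_unit : forall i, enorm (e i) = 1.
Hypothesis e_inj : injective e.
Hypothesis HH : H1 T l ls gi.

Lemma lebesgue_ae_sub (P Q : R -> Prop) : (forall s, P s -> Q s) ->
  {ae mu, forall s, P s} -> {ae mu, forall s, Q s}.
Proof. by move=> PQ [A [mA A0 PA]]; exists A; split => // s nQ; apply: PA => /PQ. Qed.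

Lemma lebesgue_ae_all (P : R -> Prop) : (forall s, P s) -> {ae mu, forall s, P s}.
Proof. by move=> HP; exists set0; split => // s; case; exact: HP. Qed.

Lemma integral_paste (a c b : R) (f f1 f2 : R -> R) : a <= c <= b ->
  (forall s, a < s <= c -> f s = f1 s) -> (forall s, c < s <= b -> f s = f2 s) ->
  ibl a c f1 -> ibl c b f2 ->
  ibl a b f /\ int a b f = int a c f1 + int c b f2.
Proof.
move=> acb E1 E2 i1 i2.
have j1 := integrable_Icc_left E1 i1; have j2 := integrable_Icc_left E2 i2.
have j := integrable_Icc_glue acb j1 j2; split => //.
by rewrite (int_Icc_chasles acb j) (eq_int_Icc_left E1 i1) (eq_int_Icc_left E2 i2).
Qed.

Lemma ctrl_paste_measurable (t c : R) (i : 'I_N) (a : R) (alpha2 : R -> ctrl R N) :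
  t <= c <= T -> ctrl_measurable T c alpha2 ->
  ctrl_measurable T t (fun s => if s <= c then (Some i, a) else alpha2 s).
Proof.
move=> /andP[tc cT] [m1 m2]; split.
  (* At time c the first control is in force, so c is removed from the level sets of the second. *)
  move=> o; rewrite (_ : _ `&` _ = (if o == Some i then Icc t c else set0) `|`
     (([set s | (alpha2 s).1 = o] `&` Icc c T) `\` [set c])).
    apply: measurableU; first by case: eqP => _; [exact: measurable_Icc|exact: measurable0].
    apply: measurableD; [exact: m1|exact: measurable_set1].
  apply/seteqP; split=> s /=.
    case: (leP s c) => sc [] /= A /IccP/andP[ts sT].
      by left; rewrite -A eqxx; apply/IccP; rewrite ts.
    right; split; last by move=> sc'; rewrite sc' ltxx in sc.
    by split => //; apply/IccP; rewrite sT ltW.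
  case=> [|[[A /IccP/andP[cs sT]] sc]].
    case: eqP => // -> /IccP/andP[ts sc]; rewrite sc; split => //.
    by apply/IccP; rewrite ts (le_trans sc).
  rewrite ifN; first by split => //; apply/IccP; rewrite sT (le_trans tc).
  by rewrite -ltNge lt_neqAle cs andbT; apply/eqP => E; apply: sc.
apply: (@measurable_Icc_glue _ t c); first by rewrite tc.
  apply: (@measurable_Icc_left _ _ _ _ (fun=> a)); last exact: measurable_cst.
  by move=> s /andP[_ ->].
apply: (measurable_Icc_left _ m2).
by move=> s /andP[cs _]; rewrite leNgt cs.
Qed.

Lemma adm_restrict t c x y alpha : t <= c <= T -> adm t x y alpha -> adm c (y c) y alpha.
Proof.
move=> /andP[tc cT] A; have [A1 [A2 A2'] A3 A4 A5] := A; split.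
- by move=> s /andP[cs sT]; apply: A1; rewrite sT (le_trans tc).
- split.
    move=> o; rewrite (_ : _ `&` _ = ([set s | (alpha s).1 = o] `&` Icc t T) `&` Icc c T).
      by apply: measurableI; [exact: A2|exact: measurable_Icc].
    rewrite -setIA; congr (_ `&` _); apply/seteqP; split=> s; last by case.
    by split => //; apply: subset_Icc H.
  by apply: measurable_funS (measurable_Icc t T) _ A2'; exact: subset_Icc.
- by apply: lebesgue_ae_sub A3 => s H sI; apply: H; apply: subset_Icc sI.
- exact: integrable_sub_Icc A4.
- by move=> s /andP[cs sT] k; exact: (adm_coord e_unit A).
Qed.

(** Resting makes the set of admissible pairs nonempty, as [inf] requires, and gives the upper bound
    on u. *)
Lemma adm_rest t i s : 0 <= s -> t <= T -> adm t (s *: e i) (fun=> s *: e i) (fun=> (Some i, 0)).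
Proof.
move=> s0 tT; split.
- by move=> r _; exact: inG_ray.
- split; last exact: measurable_cst.
  move=> o; case: (Some i =P o) => [E|E].
    by rewrite (_ : [set _ | _] = setT) ?setTI; [exact: measurable_Icc|apply/seteqP; split].
  by rewrite (_ : [set _ | _] = set0) ?set0I//; apply/seteqP; split.
- by apply: lebesgue_ae_all => r _; right; exists i; split => //; exact: rayZ.
- exact: integrable_Icc_cst.
- by move=> r /andP[tr rT] k; rewrite /fdyn /= scale0r !mxE int_Icc_cst// mul0r addr0.
Qed.

Lemma affine_ge0 (s a t c r : R) : t <= r <= c -> 0 <= s -> 0 <= s + a * (c - t) ->
  0 <= s + a * (r - t).
Proof.
move=> /andP[tr rc] s0 H; have [a0|a0] := leP 0 a.
  by rewrite addr_ge0// mulr_ge0// subr_ge0.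
by apply: (le_trans H); rewrite lerD2l ler_nM2l// lerD2r.
Qed.

(** The competitor behind the subsolution inequality: constant speed on a ray up to c, then any
    admissible continuation. Nonnegativity at the two ends of the segment suffices since the motion
    is affine. *)
Lemma adm_straight_paste t c i s a y2 alpha2 : t <= c <= T -> 0 <= s -> 0 <= s + a * (c - t) ->
  adm c ((s + a * (c - t)) *: e i) y2 alpha2 ->
  adm t (s *: e i) (fun r => if r <= c then (s + a * (r - t)) *: e i else y2 r)
    (fun r => if r <= c then (Some i, a) else alpha2 r).
Proof.
move=> tcT s0 z0 A; have [A1 A2 A3 A4 A5] := A; have /andP[tc cT] := tcT; split.
- move=> r /andP[tr rT]; case: leP => rc; last by apply: A1; rewrite rT ltW.
  by apply: inG_ray; apply: affine_ge0 z0; rewrite ?tr.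
- exact: ctrl_paste_measurable.
- apply: lebesgue_ae_sub A3 => r H /IccP/andP[tr rT]; case: leP => rc.
    by right; exists i; split => //; apply: rayZ; apply: affine_ge0 z0; rewrite ?tr.
  by apply: H; apply/IccP; rewrite rT ltW.
- have [] // := @integral_paste t c T (fun r => (if r <= c then (Some i, a) else alpha2 r).2 ^+ 2)
    (fun=> a ^+ 2) (fun r => (alpha2 r).2 ^+ 2).
  + by move=> r /andP[_ ->].
  + by move=> r /andP[cr _]; rewrite leNgt cr.
  + exact: integrable_Icc_cst.
- move=> r /andP[tr rT] k.
  pose f1 := fun _ : R => a * e i ord0 k.
  pose f r := fdyn e (if r <= c then (Some i, a) else alpha2 r) ord0 k.
  have [rc|cr] := leP r c.
    rewrite -[X in _ + Rintegral _ _ X]/f (@eq_int_Icc_left _ _ _ f f1).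
    + by rewrite int_Icc_cst// !mxE; ring.
    + by move=> q /andP[_ qr]; rewrite /f (le_trans qr)// /fdyn /= mxE.
    + exact: integrable_Icc_cst.
  rewrite -[X in _ + Rintegral _ _ X]/f.
  have [|||||_ ->] := @integral_paste t c r f f1 (fun q => fdyn e (alpha2 q) ord0 k).
  + by rewrite tc ltW.
  + by move=> q /andP[_ qc]; rewrite /f qc /fdyn /= mxE.
  + by move=> q /andP[cq _]; rewrite /f leNgt cq.
  + exact: integrable_Icc_cst.
  + exact: (adm_integrable_coord e_unit A).
  by rewrite A5 ?rT ?ltW// int_Icc_cst// !mxE; ring.
Qed.

Lemma adm_initial t x y alpha : t <= T -> adm t x y alpha -> y t = x.
Proof.
move=> tT [_ _ _ _ H]; apply/rowP => k.
by have := H t; rewrite lexx => /(_ tT k); rewrite int_Icc_point addr0 !(ord1 0).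
Qed.

Section Value.
Variable K : R.
Hypothesis K0 : 0 <= K.
Hypothesis LK : forall x t, inG e x -> 0 <= t <= T -> `|L x t| <= K.
Hypothesis gK : forall x, inG e x -> `|g x| <= K.

Lemma adm_integrable_cost t x y alpha a b : 0 <= t -> adm t x y alpha -> t <= a -> b <= T ->
  ibl a b (fun s => L (y s) s).
Proof.
move=> t0 A ta bT; apply: (integrable_sub_Icc ta bT).
apply: (@integrable_Icc_bounded _ _ _ K).
  apply: (measurable_Lcost e_unit e_inj HH t0 (lexx T)).
    by move=> s; exact: (adm_inG A).
  exact: (adm_continuous e_unit A).
by move=> s /andP[ts sT]; apply: LK; [apply: (adm_inG A)|]; rewrite ?ts ?sT ?(le_trans t0).
Qed.

Lemma Jcost_split t c x y alpha : 0 <= t -> t <= c <= T -> adm t x y alpha ->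
  J t y alpha = int t c (fun s => L (y s) s) + int t c (fun s => (alpha s).2 ^+ 2 / 2)
    + J c y alpha.
Proof.
move=> t0 /andP[tc cT] A; rewrite /Jcost.
have i1 := adm_integrable_cost t0 A (lexx t) (lexx T).
have i2 := adm_integrable_energy A (lexx t) (lexx T).
rewrite (@int_Icc_chasles _ t c T) ?tc//; last exact: integrable_IccD.
rewrite addrA; congr (_ + _ + _).
by apply: int_IccD; [exact: (adm_integrable_cost _ A)|exact: (adm_integrable_energy A)].
Qed.

Lemma adm_cost_ge t x y alpha a b : 0 <= t -> adm t x y alpha -> t <= a -> a <= b -> b <= T ->
  - K * (b - a) <= int a b (fun s => L (y s) s).
Proof.
move=> t0 A ta ab bT; rewrite -int_Icc_cst//; apply: int_Icc_le.
- exact: integrable_Icc_cst.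
- exact: (adm_integrable_cost _ A).
- move=> s /andP[as_ sb]; have ts := le_trans ta as_; have sT := le_trans sb bT.
  have := LK (adm_inG A (s := s) _) (t := s); rewrite ts sT (le_trans t0 ts) => /(_ isT isT).
  by rewrite ler_norml => /andP[].
Qed.

(** Bounds the costs from below, so that [inf] is the genuine infimum, and conversely bounds the
    energy by the cost. *)
Lemma Jcost_lower t x y alpha : 0 <= t -> t <= T -> adm t x y alpha ->
  int t T (fun s => (alpha s).2 ^+ 2 / 2) <= J t y alpha + (K * T + K).
Proof.
move=> t0 tT A; rewrite (Jcost_split (c := T) t0 _ A) ?tT ?lexx//.
rewrite /Jcost int_Icc_point add0r.
have := adm_cost_ge t0 A (lexx t) tT (lexx T).
have : `|g (y T)| <= K by apply: gK; apply: (adm_inG A); rewrite tT lexx.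
by rewrite ler_norml => /andP[]; nra.
Qed.

Lemma uval_le_J t x y alpha : 0 <= t -> t < T -> adm t x y alpha -> u x t <= J t y alpha.
Proof.
move=> t0 tT A; rewrite /uval tT; apply: ge_inf; last by exists (y, alpha).
exists (- (K * T + K)) => _ [[y' a'] /= A' <-].
by have := Jcost_lower t0 (ltW tT) A'; have := adm_energy_ge0 a' t T; lra.
Qed.

Lemma uval_nearly t x eps : 0 <= t -> t < T -> inG e x -> 0 < eps ->
  exists y alpha, adm t x y alpha /\ J t y alpha < u x t + eps.
Proof.
move=> t0 tT [i [s [s0 ->]]] eps0; rewrite /uval tT.
set S := [set _ | _ in _].
have hS : has_inf S.
  split; first by eexists; exists (fun=> s *: e i, fun=> (Some i, 0)) => //; exact: adm_rest (ltW tT).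
  exists (- (K * T + K)) => _ [[y' a'] /= A' <-].
  by have := Jcost_lower t0 (ltW tT) A'; have := adm_energy_ge0 a' t T; lra.
by have [_ [[y alpha] /= A <-] H] := inf_adherent eps0 hS; exists y, alpha.
Qed.

Lemma uval_upper t x : 0 <= t -> t < T -> inG e x -> u x t <= K * T + K.
Proof.
move=> t0 tT [i [s [s0 ->]]]; have A := adm_rest i s0 (ltW tT).
apply: (le_trans (uval_le_J t0 tT A)).
rewrite /Jcost int_IccD; [|exact: (adm_integrable_cost _ A)|exact: integrable_Icc_cst].
rewrite /= expr0n /= mul0r int_Icc_cst ?(ltW tT)// mul0r addr0.
have B : int t T (fun r => L (s *: e i) r) <= K * (T - t).
  rewrite -int_Icc_cst ?(ltW tT)//; apply: int_Icc_le.
  - exact: (adm_integrable_cost _ A).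
  - exact: integrable_Icc_cst.
  - move=> r /andP[tr rT]; apply: (le_trans (ler_norm _)); apply: LK; first exact: inG_ray.
    by rewrite rT (le_trans t0).
have Kt : 0 <= K * t := mulr_ge0 K0 t0.
have := gK (inG_ray e i s0); rewrite /= ler_norml => /andP[_]; rewrite mulrBr in B; lra.
Qed.

(** The straight segment is followed by a continuation that is optimal up to eps. *)
Lemma uval_dpp_straight t c i s a : 0 <= t -> t <= c < T -> 0 <= s -> 0 <= s + a * (c - t) ->
  u (s *: e i) t <= int t c (fun r => L ((s + a * (r - t)) *: e i) r) + a ^+ 2 / 2 * (c - t)
     + u ((s + a * (c - t)) *: e i) c.
Proof.
move=> t0 /andP[tc cT] s0 z0; apply/ler_addgt0Pr => eps eps0.
have c0 := le_trans t0 tc.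
have [y2 [alpha2 [A2 H2]]] := uval_nearly c0 cT (inG_ray e i z0) eps0.
have tcT : t <= c <= T by rewrite tc ltW.
have A := adm_straight_paste tcT s0 z0 A2.
apply: (le_trans (uval_le_J t0 (le_lt_trans tc cT) A)).
rewrite (Jcost_split t0 tcT A).
set y := fun r => _ in A *; set al := fun r => _ in A *.
have E1 : int t c (fun r => L (y r) r) = int t c (fun r => L ((s + a * (r - t)) *: e i) r).
  by apply: eq_Rintegral => r /set_mem/IccP/andP[_ rc]; rewrite /y rc.
have E2 : int t c (fun r => (al r).2 ^+ 2 / 2) = a ^+ 2 / 2 * (c - t).
  rewrite -int_Icc_cst//.
  by apply: eq_Rintegral => r /set_mem/IccP/andP[_ rc]; rewrite /al rc.
have E3 : J c y al = J c y2 alpha2.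
  (* At time c itself [y] is on the straight branch, which ends where [y2] starts. *)
  have yc r : c <= r -> y r = y2 r.
    rewrite le_eqVlt => /predU1P[<-|cr]; last by rewrite /y leNgt cr.
    by rewrite /y lexx (adm_initial (ltW cT) A2).
  rewrite /Jcost yc ?ltW//; congr (_ + _); apply: eq_int_Icc_left.
    by move=> r /andP[cr _]; rewrite yc ?ltW// /al leNgt cr.
  by apply: integrable_IccD; [exact: (adm_integrable_cost _ A2)|exact: (adm_integrable_energy A2)].
rewrite E1 E2 E3; move: H2; lra.
Qed.

(** The tail of an admissible pair is a competitor for the problem started at time c. *)
Lemma uval_dpp_adm t c x y alpha : 0 <= t -> t <= c < T -> adm t x y alpha ->
  int t c (fun s => L (y s) s) + int t c (fun s => (alpha s).2 ^+ 2 / 2) + u (y c) c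
    <= J t y alpha.
Proof.
move=> t0 /andP[tc cT] A; rewrite (Jcost_split (c := c) t0 _ A) ?tc ?(ltW cT)// lerD2l.
by apply: uval_le_J => //; [exact: le_trans tc|apply: adm_restrict A; rewrite tc ltW].
Qed.

(** One K * T + K comes from [Jcost_lower], the other from the upper bound on u, and the 1 from eps
    <= 1. *)
Lemma uval_nearly_energy t x y alpha eps : 0 <= t -> t < T -> inG e x -> eps <= 1 ->
  adm t x y alpha -> J t y alpha < u x t + eps ->
  int t T (fun s => (alpha s).2 ^+ 2 / 2) <= 2 * (K * T + K) + 1.
Proof.
move=> t0 tT Gx eps1 A H; have := Jcost_lower t0 (ltW tT) A; have := uval_upper t0 tT Gx; lra.
Qed.

End Value.
End DynamicProgramming.


(** * The viscosity inequalities on the rays and at the junction *)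

Section Viscosity.
Local Set Implicit Arguments.
Local Unset Strict Implicit.
Variables (R : realType) (N d : nat) (e : 'I_N -> 'rV[R]_d) (T : R).
Variables (l : 'I_N -> R -> R -> R) (ls : R -> R) (gi : 'I_N -> R -> R) (gs : R).
Local Notation mu := (@lebesgue_measure R).
Local Notation ibl a b f := (mu.-integrable (Icc a b) (EFin \o f)).
Local Notation int a b f := (Rintegral mu (Icc a b) f).
Local Notation L := (Lcost e l ls).
Local Notation g := (gcost e gi gs).
Local Notation J := (Jcost e T l ls gi gs).
Local Notation u := (uval e T l ls gi gs).
Local Notation adm := (admissible e T).
Hypothesis e_unit : forall i, enorm (e i) = 1.
Hypothesis e_inj : injective e.
Hypothesis HH : H1 T l ls gi.
Variable phi : 'rV[R]_d -> R -> R.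
Hypothesis phiC1 : C1G e T phi.
Variables (K : R).
Hypothesis K0 : 0 <= K.
Hypothesis LK : forall x t, inG e x -> 0 <= t <= T -> `|L x t| <= K.
Hypothesis gK : forall x, inG e x -> `|g x| <= K.

Local Notation w := (fun y s => u y s - phi y s).

Lemma phi_first_order i s t dt p : 0 <= s -> 0 < t < T ->
  has_dt phi (s *: e i) t dt -> has_dx (restr e phi i) s t p -> forall eta, 0 < eta ->
  exists2 del : R, 0 < del & forall s' t', 0 <= s' -> 0 <= t' <= T ->
    `|s' - s| < del -> `|t' - t| < del ->
    `|phi (s' *: e i) t' - phi (s *: e i) t - (t' - t) * dt - (s' - s) * p|
      <= eta * (`|t' - t| + `|s' - s|).
Proof.
move=> s0 tT Hdt Hdx eta eta0; exact: (first_order_strip (phiC1.2 i) s0 tT Hdt Hdx eta0).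
Qed.

(** Prolonged by rest after time c, the straight motion is admissible, so its cost is integrable. *)
Lemma integrable_straight t c i s a : 0 <= t -> t <= c <= T -> 0 <= s -> 0 <= s + a * (c - t) ->
  ibl t c (fun r => L ((s + a * (r - t)) *: e i) r).
Proof.
move=> t0 tcT s0 z0; have /andP[tc cT] := tcT.
have A := adm_straight_paste e_unit tcT s0 z0 (adm_rest e i z0 cT).
have := adm_integrable_cost e_unit e_inj HH LK t0 A (lexx t) cT.
by apply: integrable_Icc_left => r /andP[_ rc]; rewrite rc.
Qed.

(** The left endpoint is exempt because, at the last visit to O, the cost is l_O, which may lie
    below the bound valid on the ray at later times. *)
Lemma int_Icc_ge_left (a b k : R) (f : R -> R) : a <= b -> ibl a b f ->
  (forall s, a < s <= b -> k <= f s) -> k * (b - a) <= int a b f.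
Proof.
move=> ab fi kf; pose f' s := if s <= a then k else f s.
have E s : a < s <= b -> f' s = f s by move=> /andP[as_ _]; rewrite /f' leNgt as_.
rewrite -(eq_int_Icc_left E fi) -int_Icc_cst//; apply: int_Icc_le.
- exact: integrable_Icc_cst.
- exact: integrable_Icc_left E fi.
- by move=> s /andP[as_ sb]; rewrite /f'; case: (leP s a) => // as'; apply: kf; rewrite as'.
Qed.

(** The cap eta <= 1 lets eta^2 be absorbed into eta. *)
Lemma le_small_perturbation (A C : R) : 0 <= C -> (forall eta, 0 < eta <= 1 -> A <= eta * C) -> A <= 0.
Proof.
move=> C0 H; apply/ler_addgt0Pr => eps eps0; rewrite add0r.
pose eta := Order.min 1 (eps / (C + 1)).
have C1 : 0 < C + 1 by rewrite ltr_wpDl.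
have eta0 : 0 < eta <= 1 by rewrite lt_min ltr01 divr_gt0//= ge_min lexx.
have : eta * (C + 1) <= eps by rewrite -ler_pdivlMr// ge_min lexx orbT.
by have := H eta eta0; move/andP: eta0 => [? _]; nra.
Qed.

(** Common core of the subsolution inequalities, with the speed a left free. The displacement is a *
    h, so the dynamic programming inequality can be divided by h. [Lbar] is l_i(s, t) in motion and
    l_O(t) at rest in O. The alternative on s and a keeps the motion on the ray. *)
Lemma subsolution_along t i s a dt p Lbar : 0 < t < T -> 0 <= s -> 0 < s \/ 0 <= a ->
  has_dt phi (s *: e i) t dt -> has_dx (restr e phi i) s t p ->
  (forall eps, 0 < eps -> exists2 del : R, 0 < del & forall r, t <= r <= T -> r - t < del ->
     L ((s + a * (r - t)) *: e i) r <= Lbar + eps) ->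
  loc_max e T w (s *: e i) t -> 0 <= Lbar + a ^+ 2 / 2 + dt + a * p.
Proof.
move=> tT s0 sa Hdt Hdx HL [rad rad0 Hmax]; have /andP[t0 tT'] := tT.
rewrite -oppr_le0; apply: (@le_small_perturbation _ (2 + `|a|)); first by rewrite addr_ge0.
move=> eta /andP[eta0 _].
have [d1 d10 H1] := phi_first_order s0 tT Hdt Hdx eta0.
have [d2 d20 H2] := HL eta eta0.
(* For s = 0 the value 1 is irrelevant: the motion then leaves O outwards or rests. *)
pose sp := if 0 < s then s else 1.
have sp0 : 0 < sp by rewrite /sp; case: ifP.
pose m := Order.min (Order.min (Order.min d1 d2) (Order.min rad (T - t))) sp.
have m0 : 0 < m by rewrite !lt_min d10 d20 rad0 subr_gt0 tT'.
have [m1 m2 m3 m4 m5] : [/\ m <= d1, m <= d2, m <= rad, m <= T - t & m <= sp].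
  by rewrite /m; split; rewrite !ge_min lexx ?orbT.
have a1 : 0 < 2 * (1 + `|a|) by rewrite mulr_gt0// ltr_pwDl.
(* Both h and |a| * h are then below m; for s > 0, m <= s keeps the abscissa nonnegative. *)
pose h := m / (2 * (1 + `|a|)).
have h0 : 0 < h by rewrite divr_gt0.
have na := normr_ge0 a.
have hm : 2 * h + 2 * (`|a| * h) = m by rewrite /h; field; rewrite gt_eqF// ltr_pwDl.
have ah0 : 0 <= `|a| * h by rewrite mulr_ge0// ltW.
have hm1 : h < m by lra.
have ahm : `|a * h| < m by rewrite normrM (gtr0_norm h0); lra.
pose c := t + h; pose s' := s + a * h.
have ct : c - t = h by rewrite /c addrAC subrr add0r.
have ss : s' - s = a * h by rewrite /s' addrAC subrr add0r.
have s'0 : 0 <= s'.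
  case: sa => [sgt|a0]; last by rewrite addr_ge0// mulr_ge0// ltW.
  have : m <= s by move: m5; rewrite /sp sgt.
  by move: ahm; rewrite ltr_norml /s' => /andP[]; lra.
have z0 : 0 <= s + a * (c - t) by rewrite ct.
have tc : t <= c by rewrite /c lerDl ltW.
have cT : c < T by rewrite /c; lra.
have cI : 0 <= c <= T by rewrite (le_trans (ltW t0)) ?(ltW cT).
have D := uval_dpp_straight e_unit e_inj HH LK gK i (ltW t0) (introT andP (conj tc cT)) s0 z0.
have B : int t c (fun r => L ((s + a * (r - t)) *: e i) r) <= (Lbar + eta) * h.
  rewrite -ct -int_Icc_cst//; apply: int_Icc_le.
  - by apply: integrable_straight; rewrite ?(ltW t0)// tc ltW.
  - exact: integrable_Icc_cst.
  - move=> r /andP[tr rc]; apply: H2; first by rewrite tr (le_trans rc)// ltW.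
    by move: ct; lra.
have M := Hmax (s' *: e i) c (inG_ray e i s'0) cI.
rewrite gdist_ray// ss ct (gtr0_norm h0) in M.
have := M (lt_le_trans ahm m3) (lt_le_trans hm1 m3) => {}M.
have := H1 s' c s'0 cI; rewrite ss ct (gtr0_norm h0) => /(_ (lt_le_trans ahm m1) (lt_le_trans hm1 m1)).
rewrite normrM (gtr0_norm h0) => /ler_normlP[_ F].
rewrite ct -/s' in D.
rewrite -(ler_pM2l h0).
move: D M F B; rewrite /=; move: (u _ _) (u _ _) (phi _ _) (phi _ _) (int _ _ _) => *.
nra.
Qed.

(** At s = 0 the cost may jump when the motion starts, from l_O(t) to values near l_i(O, t); since
    l_O <= l_i(O, .), the upper bound survives. *)
Lemma Lcost_straight_near t i s a : 0 < t < T -> 0 <= s -> 0 < s \/ 0 < a ->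
  forall eps, 0 < eps -> exists2 del : R, 0 < del & forall r, t <= r <= T -> r - t < del ->
    L ((s + a * (r - t)) *: e i) r <= l i s t + eps.
Proof.
move=> /andP[t0 tT] s0 sa eps eps0.
have tI : 0 <= t <= T by rewrite !ltW.
have [d1 d10 H1] := l_eps HH i s0 tI eps0.
pose sp := if 0 < s then s else 1.
have sp0 : 0 < sp by rewrite /sp; case: ifP.
pose m := Order.min d1 sp.
have m0 : 0 < m by rewrite lt_min d10.
have [m1 m2] : m <= d1 /\ m <= sp by rewrite /m; split; rewrite ge_min lexx ?orbT.
clearbody m.
have a1 : 0 < 1 + `|a| by rewrite ltr_pwDl.
exists (m / (1 + `|a|)); first exact: divr_gt0.
move=> r /andP[tr rT]; rewrite ltr_pdivlMr// => rm.
have h0 : 0 <= r - t by rewrite subr_ge0.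
have ah : `|a * (r - t)| < m.
  by rewrite normrM (ger0_norm h0); have := normr_ge0 a; nra.
have rm' : `|r - t| < m.
  have ha : 0 <= (r - t) * `|a| by rewrite mulr_ge0.
  by rewrite ger0_norm//; lra.
have rI : 0 <= r <= T by rewrite rT (le_trans (ltW t0)).
have [sgt|sz] := ltP 0 s.
  have sm : m <= s by move: m2; rewrite /sp sgt.
  have v0 : 0 < s + a * (r - t) by move: ah; rewrite ltr_norml => /andP[]; lra.
  rewrite Lcost_ray//; have := H1 _ r (ltW v0) rI.
  rewrite [s + _]addrC addrK => /(_ (lt_le_trans ah m1) (lt_le_trans rm' m1)).
  by rewrite ltr_norml => /andP[]; lra.
have s00 : s = 0 by apply/eqP; rewrite eq_le s0 sz.
have a0 : 0 < a by case: sa => //; rewrite s00 ltxx.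
have [rt|rt] := eqVneq r t.
  rewrite rt subrr mulr0 addr0 s00 scale0r Lcost0.
  by have := lO_le l ls i t; lra.
have v0 : 0 < s + a * (r - t).
  by rewrite s00 add0r mulr_gt0// subr_gt0 lt_neqAle eq_sym rt.
rewrite Lcost_ray//; have := H1 _ r (ltW v0) rI.
rewrite [s + _]addrC addrK => /(_ (lt_le_trans ah m1) (lt_le_trans rm' m1)).
by rewrite ltr_norml => /andP[]; lra.
Qed.

(** The speed a = - p attains the supremum in H_i. *)
Lemma subsolution_interior t i s dt p : 0 < t < T -> 0 < s ->
  has_dt phi (s *: e i) t dt -> has_dx (restr e phi i) s t p ->
  loc_max e T w (s *: e i) t -> p ^+ 2 / 2 - l i s t <= dt.
Proof.
move=> tT s0 Hdt Hdx Hmax.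
have := subsolution_along (a := - p) tT (ltW s0) (or_introl s0) Hdt Hdx
  (Lcost_straight_near i tT (ltW s0) (or_introl s0)) Hmax.
by rewrite sqrrN; lra.
Qed.

Lemma subsolution_junction t dt (p : 'I_N -> R) : 0 < t < T -> (0 < N)%N ->
  has_dt phi 0 t dt -> (forall i, has_dx (restr e phi i) 0 t (p i)) ->
  loc_max e T w 0 t -> HO l ls t p <= dt.
Proof.
move=> tT N0 Hdt Hdx Hmax; have /andP[t0 tT'] := tT.
have tI : 0 <= t <= T by rewrite !ltW.
have at0 i : 0 *: e i = 0 by exact: scale0r.
have rest : - lO l ls t <= dt.
  pose i := Ordinal N0.
  have Hdt' : has_dt phi (0 *: e i) t dt by rewrite at0.
  have Hmax' : loc_max e T w (0 *: e i) t by rewrite at0.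
  have HL eps : 0 < eps -> exists2 del : R, 0 < del & forall r, t <= r <= T -> r - t < del ->
      L ((0 + 0 * (r - t)) *: e i) r <= lO l ls t + eps.
    move=> eps0; have [del del0 H] := lO_eps HH tI eps0; exists del => // r /andP[tr rT] rd.
    rewrite mul0r addr0 at0 Lcost0; have := H r.
    rewrite rT (le_trans (ltW t0) tr) ger0_norm ?subr_ge0// => /(_ isT rd).
    by rewrite ltr_norml => /andP[]; lra.
  have := subsolution_along tT (lexx 0) (or_intror (lexx 0)) Hdt' (Hdx i) HL Hmax'.
  by rewrite expr0n /= mul0r; lra.
(* For p_i >= 0 the entry is - l_i(O, t) <= - l_O(t), covered by resting. For p_i < 0 the maximising
   speed - p_i points outwards and is available at O. *)
apply: bigmax_le => // i _; rewrite /Hdown; case: (leP (p i) 0) => pi; last first.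
  by have := lO_le l ls i t; lra.
have [p0|pn] := eqVneq (p i) 0.
  by rewrite p0 expr0n /= mul0r; have := lO_le l ls i t; lra.
have ap : 0 < - p i by rewrite oppr_gt0 lt_neqAle pn.
have Hdt' : has_dt phi (0 *: e i) t dt by rewrite at0.
have Hmax' : loc_max e T w (0 *: e i) t by rewrite at0.
have := subsolution_along tT (lexx 0) (or_intror (ltW ap)) Hdt' (Hdx i)
  (Lcost_straight_near i tT (lexx 0) (or_intror ap)) Hmax'.
by rewrite sqrrN; lra.
Qed.

(** The weight |p| + eta cancels |p| * X and eta * X together. The 3 counts the errors from the
    running cost, the expansion and near-optimality. *)
Lemma interior_algebra (h A E D X p dt eta lb Delta : R) : 0 < h -> 0 <= X -> `|D| = X ->
  (lb - eta) * h <= A -> (`|p| + eta) * X <= E + (`|p| + eta) ^+ 2 * h / 2 ->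
  `|Delta - h * dt - D * p| <= eta * (h + X) -> A + E + Delta <= eta * h ->
  dt + lb - (`|p| + eta) ^+ 2 / 2 <= 3 * eta.
Proof.
move=> h0 X0 DX HA HE /ler_normlP[HD _] H.
have Dp : - (`|p| * X) <= D * p.
  by rewrite -DX -normrM mulrC; have := ler_norm (- (D * p)); rewrite normrN; lra.
rewrite -(ler_pM2l h0); nra.
Qed.

Lemma supersolution_interior t i s dt p : 0 < t < T -> 0 < s ->
  has_dt phi (s *: e i) t dt -> has_dx (restr e phi i) s t p ->
  loc_min e T w (s *: e i) t -> dt <= p ^+ 2 / 2 - l i s t.
Proof.
move=> tT s0 Hdt Hdx [rad rad0 Hmin]; have /andP[t0 tT'] := tT.
have tI : 0 <= t <= T by rewrite !ltW.
(* The constant is 3 from [interior_algebra] plus |p| + 1, which bounds (|p| + eta)^2 / 2 - p^2 / 2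
   after division by eta <= 1. *)
rewrite -subr_le0; apply: (@le_small_perturbation _ (4 + `|p|)); first by rewrite addr_ge0.
move=> eta /andP[eta0 eta1].
have [d1 d10 H1] := phi_first_order (ltW s0) tT Hdt Hdx eta0.
have [d2 d20 H2] := l_eps HH i (ltW s0) tI eta0.
pose m := Order.min (Order.min d1 d2) rad.
have m0 : 0 < m by rewrite !lt_min d10 d20 rad0.
have [m1 m2 m3] : [/\ m <= d1, m <= d2 & m <= rad].
  by rewrite /m; split; rewrite !ge_min lexx ?orbT.
clearbody m.
have [eps1 eps10 Hray] := near_ray e_unit e_inj i s0 m0.
have C0 : 0 <= 2 * (K * T + K) + 1.
  have KT : 0 <= K * T by rewrite mulr_ge0 ?(le_trans (ltW t0) (ltW tT')).
  by rewrite addr_ge0// mulr_ge0// addr_ge0.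
(* Fixed before h and the trajectory: C0 bounds the energy of every pair that is optimal up to 1. *)
have [d3 d30 Hyoung] := young_small C0 eps10.
pose h := Order.min (Order.min m d3) (Order.min (T - t) 1) / 2.
have mm0 : 0 < Order.min (Order.min m d3) (Order.min (T - t) 1).
  by rewrite !lt_min m0 d30 subr_gt0 tT' ltr01.
have h0 : 0 < h by rewrite divr_gt0.
have hmm : h < Order.min (Order.min m d3) (Order.min (T - t) 1) by rewrite /h; lra.
have [hm hd3 hT h1] : [/\ h < m, h < d3, h < T - t & h < 1].
  by move: hmm; rewrite !lt_min => /andP[/andP[-> ->] /andP[-> ->]].
pose c := t + h.
have ct : c - t = h by rewrite /c addrAC subrr add0r.
have tc : t <= c by rewrite /c lerDl ltW.
have cT : c < T by rewrite /c; lra.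
have cI : 0 <= c <= T by rewrite (le_trans (ltW t0)) ?(ltW cT).
have Gx := inG_ray e i (ltW s0).
have etah0 : 0 < eta * h by rewrite mulr_gt0.
have [y [alpha [A HJ]]] := uval_nearly e_unit e_inj HH LK gK (ltW t0) tT' Gx etah0.
have etah1 : eta * h <= 1 by rewrite mulr_ile1// ltW.
have EC := uval_nearly_energy e_unit e_inj HH K0 LK gK (ltW t0) tT' Gx etah1 A HJ.
have yt := adm_initial (ltW tT') A.
(* On [t, c] the path cannot leave J_i, since its projections move by less than the radius of
   [near_ray]. *)
have near r : t <= r <= c -> exists2 s', 0 < s' & y r = s' *: e i /\ `|s' - s| < m.
  move=> /andP[tr rc]; have rT := le_trans rc (ltW cT).
  apply: Hray; first by apply: (adm_inG A); rewrite tr.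
  move=> k; apply/ltW; apply: (Hyoung _ (int t r (fun s => (alpha s).2 ^+ 2 / 2)) (r - t)).
  - exact: le_trans (adm_energy_sub A (lexx t) tr rT) EC.
  - by move: ct hd3; lra.
  - move=> lam lam0; rewrite -yt.
    by apply: (adm_young e_unit A) => // j; exact: dot_ee_norm.
have [s' s'0 [yc s's]] := near c (introT andP (conj tc (lexx c))).
have D := uval_dpp_adm e_unit e_inj HH LK gK (ltW t0) (introT andP (conj tc cT)) A.
have B : (l i s t - eta) * h <= int t c (fun r => L (y r) r).
  rewrite -ct; apply: int_Icc_ge_left => //.
    exact: (adm_integrable_cost e_unit e_inj HH LK (ltW t0) A (lexx t) (ltW cT)).
  move=> r /andP[/ltW tr rc].
  have [r' r'0 [-> rs]] := near r (introT andP (conj tr rc)).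
  rewrite Lcost_ray//.
  have := H2 r' r (ltW r'0); rewrite (le_trans (ltW t0) tr) (le_trans rc (ltW cT)) => /(_ isT).
  move=> /(_ (lt_le_trans rs m2)); rewrite ger0_norm ?subr_ge0// => /(_ ltac:(lra)).
  by rewrite ltr_norml => /andP[]; lra.
have M := Hmin (y c) c (adm_inG A (introT andP (conj tc (ltW cT)))) cI.
rewrite yc (gdist_ray e_unit _ (ltW s0) (ltW s'0)) ct (gtr0_norm h0) in M.
have := M (lt_le_trans s's m3) (lt_le_trans hm m3) => {}M.
have := H1 s' c (ltW s'0) cI (lt_le_trans s's m1).
rewrite ct (gtr0_norm h0) => /(_ (lt_le_trans hm m1)) F.
have lam0 : 0 <= `|p| + eta by rewrite addr_ge0// ltW.
have Y := adm_young e_unit A (lexx t) tc (ltW cT) lam0 (fun k => dot_ee_norm e_unit k i).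
rewrite yt yc -scalerBl dotZl dot_ee// mulr1 ct in Y.
rewrite yc in D.
have Z := interior_algebra h0 (normr_ge0 _) erefl B Y F.
have {}Z : dt + l i s t - (`|p| + eta) ^+ 2 / 2 <= 3 * eta.
  by apply: Z; move: D M HJ; lra.
have := real_normK (num_real p); have := normr_ge0 p.
move: Z; nra.
Qed.

(** Here h1 and h2 are the durations before and after the last visit to O, E is the energy of the
    second piece, and M stands for H_O. The costs of the pieces are bounded through - M * h1 and - M
    * h2, whatever their proportion. The factor 4 + Lam is 3 as on a ray, plus 1 + Lam from
    expanding (lam + eta)^2 / 2. *)
Lemma junction_algebra (h1 h2 A E r p lam eta Lam lo lj dt M Delta : R) :
  0 <= h1 -> 0 <= h2 -> 0 < h1 + h2 -> 0 <= r -> 0 <= lam -> lam <= Lam -> 0 < eta -> eta <= 1 ->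
  - lam <= p -> - M <= lo -> - M <= lj - lam ^+ 2 / 2 ->
  (lo - eta) * h1 + (lj - eta) * h2 <= A ->
  (lam + eta) * r <= E + (lam + eta) ^+ 2 * h2 / 2 ->
  `|Delta - (h1 + h2) * dt - r * p| <= eta * (h1 + h2 + r) ->
  A + E + Delta <= eta * (h1 + h2) ->
  dt - M <= eta * (4 + Lam).
Proof.
move=> h10 h20 h0 r0 lam0 lamL eta0 eta1 lp Mlo Mlj HA HE /ler_normlP[HD _] H.
have rp : - (lam * r) <= r * p by rewrite (mulrC r) -mulNr ler_wpM2r.
have Q1 : - M * h1 <= lo * h1 by rewrite ler_wpM2r.
have Q2 : - M * h2 <= (lj - lam ^+ 2 / 2) * h2 by rewrite ler_wpM2r.
have Q3 : (lam * eta + eta ^+ 2 / 2) * h2 <= eta * (1 + Lam) * h2 by rewrite ler_wpM2r//; nra.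
have Q4 : 0 <= eta * (1 + Lam) * h1 by rewrite !mulr_ge0//; lra.
have S : (h1 + h2) * (dt - M) <= (h1 + h2) * (eta * (4 + Lam)) by lra.
by rewrite ler_pM2l in S.
Qed.

(** Lower semicontinuity of L at O, uniform over the rays, because l_O(t) <= l_k(O, t). *)
Lemma Lcost_junction_ge t y r eta del : inG e y -> 
  (forall r', 0 <= r' <= T -> `|r' - t| < del -> `|lO l ls r' - lO l ls t| < eta) ->
  (forall k s' r', 0 <= s' -> 0 <= r' <= T -> `|s' - 0| < del -> `|r' - t| < del ->
     `|l k s' r' - l k 0 t| < eta) ->
  0 <= r <= T -> `|r - t| < del -> enorm y < del -> lO l ls t - eta <= L y r.
Proof.
move=> [k [s [s0 ->]]] HO Hl rT rt; rewrite enormZe// ger0_norm// => sd.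
have [->|sn] := eqVneq s 0.
  rewrite scale0r Lcost0; have := HO r rT rt.
  by rewrite ltr_norml => /andP[]; lra.
rewrite Lcost_ray//; last by rewrite lt_neqAle eq_sym sn.
have := Hl k s r s0 rT; rewrite subr0 ger0_norm// => /(_ sd rt).
by rewrite ltr_norml => /andP[]; have := lO_le l ls k t; lra.
Qed.

Lemma supersolution_junction t dt (p : 'I_N -> R) : 0 < t < T -> (0 < N)%N ->
  has_dt phi 0 t dt -> (forall i, has_dx (restr e phi i) 0 t (p i)) ->
  loc_min e T w 0 t -> dt <= HO l ls t p.
Proof.
move=> tT N0 Hdt Hdx [rad rad0 Hmin]; have /andP[t0 tT'] := tT.
have tI : 0 <= t <= T by rewrite !ltW.
(* The exit ray depends on the trajectory, hence on eta, so the error constant must dominate every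
   |p_i|. *)
pose Lam := \sum_i `|p i|.
have Lam0 : 0 <= Lam by rewrite sumr_ge0.
have pLam i : `|p i| <= Lam by rewrite /Lam (bigD1 i)//= lerDl sumr_ge0.
rewrite -subr_le0; apply: (@le_small_perturbation _ (4 + Lam)); first by rewrite addr_ge0.
move=> eta /andP[eta0 eta1].
have [d1 d10 H1] : exists2 d1 : R, 0 < d1 & forall i s' t', 0 <= s' -> 0 <= t' <= T ->
    `|s' - 0| < d1 -> `|t' - t| < d1 ->
    `|phi (s' *: e i) t' - phi (0 *: e i) t - (t' - t) * dt - (s' - 0) * p i|
      <= eta * (`|t' - t| + `|s' - 0|).
  apply: (@finite_uniform_radius R N (fun i d1 => forall s' t', 0 <= s' -> 0 <= t' <= T ->
    `|s' - 0| < d1 -> `|t' - t| < d1 ->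
    `|phi (s' *: e i) t' - phi (0 *: e i) t - (t' - t) * dt - (s' - 0) * p i|
      <= eta * (`|t' - t| + `|s' - 0|))).
    move=> i q q' _ qq' H s' t' s'0 t'T sq tq.
    by apply: H => //; [exact: lt_le_trans sq qq'|exact: lt_le_trans tq qq'].
  by move=> i; apply: phi_first_order => //; rewrite scale0r.
have [d2 d20 H2] : exists2 d2 : R, 0 < d2 & forall k s' r', 0 <= s' -> 0 <= r' <= T ->
     `|s' - 0| < d2 -> `|r' - t| < d2 -> `|l k s' r' - l k 0 t| < eta.
  apply: (@finite_uniform_radius R N (fun k d2 => forall s' r', 0 <= s' -> 0 <= r' <= T ->
     `|s' - 0| < d2 -> `|r' - t| < d2 -> `|l k s' r' - l k 0 t| < eta)).
    move=> i q q' _ qq' H s' t' s'0 t'T sq tq.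
    by apply: H => //; [exact: lt_le_trans sq qq'|exact: lt_le_trans tq qq'].
  by move=> k; exact: (l_eps HH).
have [d3 d30 H3] := lO_eps HH tI eta0.
pose m := Order.min (Order.min d1 d2) (Order.min d3 rad).
have m0 : 0 < m by rewrite !lt_min d10 d20 d30 rad0.
have [m1 m2 m3 m4] : [/\ m <= d1, m <= d2, m <= d3 & m <= rad].
  by rewrite /m; split; rewrite !ge_min lexx ?orbT.
clearbody m.
have C0 : 0 <= 2 * (K * T + K) + 1.
  by rewrite addr_ge0// mulr_ge0// addr_ge0// mulr_ge0// (le_trans (ltW t0) (ltW tT')).
have m20 : 0 < m / 2 by rewrite divr_gt0.
have [d4 d40 Hyoung] := young_small C0 m20.
pose q := Order.min (Order.min m d4) (Order.min (T - t) 1).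
have q0 : 0 < q by rewrite !lt_min m0 d40 subr_gt0 tT' ltr01.
pose h := q / 2.
have h0 : 0 < h by rewrite divr_gt0.
have hq : h < q by rewrite /h; lra.
have [hm hd4 hT h1] : [/\ h < m, h < d4, h < T - t & h < 1].
  by move: hq; rewrite !lt_min => /andP[/andP[-> ->] /andP[-> ->]].
clearbody h.
pose c := t + h.
have ct : c - t = h by rewrite /c addrAC subrr add0r.
have tc : t <= c by rewrite /c lerDl ltW.
have cT : c < T by rewrite /c; lra.
clearbody c.
have cI : 0 <= c <= T by rewrite (le_trans (ltW t0)) ?(ltW cT).
pose i0 := Ordinal N0.
have Gx : inG e 0 by exists i0; exact: ray0.
have etah0 : 0 < eta * h by rewrite mulr_gt0.
have [y [alpha [A HJ]]] := uval_nearly e_unit e_inj HH LK gK (ltW t0) tT' Gx etah0.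
have etah1 : eta * h <= 1 by rewrite mulr_ile1// ltW.
have EC := uval_nearly_energy e_unit e_inj HH K0 LK gK (ltW t0) tT' Gx etah1 A HJ.
have yt := adm_initial (ltW tT') A.
have Gy r : t <= r <= c -> inG e (y r).
  by move=> /andP[tr rc]; apply: (adm_inG A); rewrite tr (le_trans rc)// ltW.
have near r : t <= r <= c -> exists k s', [/\ 0 <= s', s' < m & y r = s' *: e k].
  move=> trc; have /andP[tr rc] := trc; have rT := le_trans rc (ltW cT).
  have [|k [s' [s'0 s'm E]]] := radial_le e_unit (eps := m / 2) (Gy r trc).
    move=> k; apply/ltW; apply: (Hyoung _ (int t r (fun s => (alpha s).2 ^+ 2 / 2)) (r - t)).
    - exact: le_trans (adm_energy_sub A (lexx t) tr rT) EC.
    - by move: ct hd4; lra.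
    - move=> lam lam0; rewrite -[y r]subr0 -[in X in _ - X]yt.
      by apply: (adm_young e_unit A) => // j; exact: dot_ee_norm.
  by exists k, s'; split => //; lra.
have [j [r [r0 rm yc]]] := near c (introT andP (conj tc (lexx c))).
(* If the path ends at O, the last visit is c itself and the second piece degenerates to a point. *)
have [c0 /andP[tc0 c0c] [yc0 Hexit]] : exists2 c0, t <= c0 <= c & y c0 = 0 /\
    forall s, c0 < s <= c -> exists2 s', 0 < s' & y s = s' *: e j.
  have [rz|rn] := eqVneq r 0.
    exists c; rewrite ?tc ?lexx//; split; first by rewrite yc rz scale0r.
    by move=> s /andP[cs sc]; move: (lt_le_trans cs sc); rewrite ltxx.
  have rp : 0 < r by rewrite lt_neqAle eq_sym rn.
  have cy k : {within (Icc t c), continuous (fun s => y s ord0 k)}.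
    have cT' : Icc t c `<=` Icc t T by apply: subset_Icc => //; exact: ltW.
    exact: (continuous_subspaceW cT' (adm_continuous e_unit A (k := k))).
  have [c0 /andP[tc0 c0c] H] := ray_last_exit e_unit e_inj tc cy Gy yt rp yc.
  by exists c0; rewrite // tc0 ltW.
have D := uval_dpp_adm e_unit e_inj HH LK gK (ltW t0) (introT andP (conj tc cT)) A.
have iL a b ta bT := adm_integrable_cost e_unit e_inj HH LK (a := a) (b := b) (ltW t0) A ta bT.
have tcI s : t <= s <= c -> 0 <= s <= T.
  by move=> /andP[ts sc]; rewrite (le_trans (ltW t0) ts) (le_trans sc (ltW cT)).
have tsm s : t <= s <= c -> `|s - t| < m.
  by move=> /andP[ts sc]; rewrite ger0_norm ?subr_ge0//; lra.
have Lge s : t <= s <= c -> lO l ls t - eta <= L (y s) s.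
  move=> ts; apply: (@Lcost_junction_ge t (y s) s eta m (Gy s ts)).
  - by move=> r' r'T r't; apply: H3 => //; exact: lt_le_trans r't m3.
  - move=> k s' r' s'0 r'T sm' r'm.
    by apply: H2 => //; [exact: lt_le_trans sm' m2|exact: lt_le_trans r'm m2].
  - exact: tcI.
  - exact: tsm.
  - by have [k [s' [s'0 s'm ->]]] := near s ts; rewrite enormZe// ger0_norm.
have B1 : (lO l ls t - eta) * (c0 - t) <= int t c0 (fun s => L (y s) s).
  apply: int_Icc_ge_left => //; first by apply: iL => //; exact: le_trans c0c (ltW cT).
  by move=> s /andP[/ltW ts sc]; apply: Lge; rewrite ts (le_trans sc).
have B2 : (l j 0 t - eta) * (c - c0) <= int c0 c (fun s => L (y s) s).
  apply: int_Icc_ge_left => //; first by apply: iL => //; exact: ltW.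
  move=> s cs; have [s' s'0 E] := Hexit s cs; have /andP[c0s sc] := cs.
  have ts : t <= s <= c by rewrite sc (le_trans tc0)// ltW.
  (* The abscissa given by the exit and the small one given by [near] describe the same point off O,
     so they agree. *)
  have sm : s' < m.
    have [k [s'' [s''0 s''m E']]] := near s ts.
    by have [_ ->] := ray_inj e_unit e_inj s'0 s''0 (etrans (esym E) E').
  rewrite E Lcost_ray//; have := H2 j s' s (ltW s'0) (tcI s ts).
  rewrite subr0 gtr0_norm// => /(_ (lt_le_trans sm m2) (lt_le_trans (tsm s ts) m2)).
  by rewrite ltr_norml => /andP[]; lra.
have BL : int t c (fun s => L (y s) s) = int t c0 (fun s => L (y s) s) + int c0 c (fun s => L (y s) s).
  by apply: int_Icc_chasles; rewrite ?tc0//; apply: iL => //; exact: ltW.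
have BE : int t c (fun s => (alpha s).2 ^+ 2 / 2) =
    int t c0 (fun s => (alpha s).2 ^+ 2 / 2) + int c0 c (fun s => (alpha s).2 ^+ 2 / 2).
  apply: int_Icc_chasles; rewrite ?tc0//.
  by apply: (adm_integrable_energy A) => //; exact: ltW.
(* The energy spent before the last visit is discarded by its sign. *)
have E0 := adm_energy_ge0 alpha t c0.
have M := Hmin (y c) c (Gy c (introT andP (conj tc (lexx c)))) cI.
have gd : gdist e 0 (y c) = r.
  by rewrite yc -(scale0r (e j)) gdist_ray// subr0 ger0_norm.
rewrite gd in M; have := M (lt_le_trans rm m4).
rewrite ct (gtr0_norm h0) => /(_ (lt_le_trans hm m4)) {}M.
have := H1 j r c r0 cI; rewrite subr0 (ger0_norm r0) ct (gtr0_norm h0) scale0r.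
move=> /(_ (lt_le_trans rm m1) (lt_le_trans hm m1)) F.
(* The least nonnegative weight with r * p_j >= - lam * r; moreover lam^2 / 2 - l_j(O, t) is
   H_j^down(O, t, p_j). *)
pose lam := Order.max (- p j) 0.
have lam0 : 0 <= lam by rewrite le_max lexx orbT.
have lamp : - lam <= p j by rewrite lerNl le_max lexx.
have lamL : lam <= Lam.
  by rewrite ge_max Lam0 andbT (le_trans _ (pLam j))// -normrN ler_norm.
have lamH : - HO l ls t p <= l j 0 t - lam ^+ 2 / 2.
  have : Hdown l j t (p j) <= HO l ls t p by rewrite /HO; exact: (le_bigmax _ (fun i => Hdown l i t (p i))).
  rewrite /Hdown /lam; case: (leP (p j) 0) => pj.
    by rewrite (max_idPl _) ?oppr_ge0// sqrrN; lra.
  by rewrite (max_idPr _) ?oppr_le0 ?(ltW pj)// expr0n /= mul0r subr0; lra.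
have loH : - HO l ls t p <= lO l ls t by rewrite lerNl; exact: bigmax_ge_id.
have lame0 : 0 <= lam + eta by rewrite addr_ge0// ltW.
have Y := adm_young e_unit A tc0 c0c (ltW cT) lame0 (fun k => dot_ee_norm e_unit k j).
rewrite yc0 yc subr0 dotZl dot_ee// mulr1 (ger0_norm r0) in Y.
have hh : (c0 - t) + (c - c0) = h by rewrite -ct; ring.
apply: (@junction_algebra (c0 - t) (c - c0) (int t c (fun s => L (y s) s))
  (int c0 c (fun s => (alpha s).2 ^+ 2 / 2)) r (p j) lam eta Lam (lO l ls t) (l j 0 t) dt
  (HO l ls t p) (phi (y c) c - phi 0 t)) => //.
- by rewrite subr_ge0.
- by rewrite subr_ge0.
- by rewrite hh.
- by rewrite BL; exact: lerD.
- by rewrite hh yc.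
- by rewrite hh; move: D M HJ; rewrite BE /=; lra.
Qed.

End Viscosity.


(** * Assembly of the terminal condition and the four inequalities *)

Theorem mainTheorem7 (R : realType) (N d : nat) (e : 'I_N -> 'rV[R]_d) (T : R)
  (l : 'I_N -> R -> R -> R) (ls : R -> R) (gi : 'I_N -> R -> R) (gs : R) :
  (2 <= N)%N -> (1 <= d)%N -> (forall i, enorm (e i) = 1) -> injective e -> 0 < T ->
  H1 T l ls gi ->
  let u := uval e T l ls gi gs in
  (forall x, inG e x -> u x T = gcost e gi gs x) /\
  (forall phi, C1G e T phi ->
    let w := fun y s => u y s - phi y s in
    (* points of J_i \ {O} : x = s e_i with s > 0 *)
    (forall (i : 'I_N) (s t : R), 0 < s -> 0 < t < T ->
       forall dt p, has_dt phi (s *: e i) t dt -> has_dx (restr e phi i) s t p ->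
       (loc_max e T w (s *: e i) t -> - dt + Hi l i s t p <= 0) /\
       (loc_min e T w (s *: e i) t -> - dt + Hi l i s t p >= 0)) /\
    (* the junction O *)
    (forall t : R, 0 < t < T ->
       forall dt (p : 'I_N -> R), has_dt phi 0 t dt ->
       (forall i, has_dx (restr e phi i) 0 t (p i)) ->
       (loc_max e T w 0 t -> - dt + HO l ls t p <= 0) /\
       (loc_min e T w 0 t -> - dt + HO l ls t p >= 0))).
Proof.
move=> N2 _ e_unit e_inj T0 HH u; split=> [x _|phi phiC1 w].
  by rewrite /u /uval ltxx.
have [K K0 [LK gK]] := cost_bounded gs e_unit e_inj HH.
have N0 : (0 < N)%N by exact: ltnW.
split=> [i s t s0 tT dt p Hdt Hdx|t tT dt p Hdt Hdx]; split=> H; rewrite addrC.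
- by rewrite subr_le0; apply: (subsolution_interior e_unit e_inj HH phiC1 LK gK tT s0 Hdt Hdx).
- by rewrite subr_ge0; apply: (supersolution_interior e_unit e_inj HH phiC1 K0 LK gK tT s0 Hdt Hdx).
- by rewrite subr_le0; apply: (subsolution_junction e_unit e_inj HH phiC1 LK gK tT N0 Hdt Hdx).
- by rewrite subr_ge0; apply: (supersolution_junction e_unit e_inj HH phiC1 K0 LK gK tT N0 Hdt Hdx).
Qed.
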